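(* Let $\Lambda$ be a finite lattice, $N\ge1$, $\beta>0$, and let $s=(\ell_1,\dots,\ell_n)$ be a string. For lattice Yang–Mills theory with gauge group $O(N)$, $$\langle W_s\rangle_{\Lambda,\beta}=Z_{\Lambda,\beta}^{-1}\sum_{(\mathcal M,\phi)\in\mathrm{EPE}_{\mathrm{OS}}(s)}\frac{\beta^{\mathrm{area}(\mathcal M,\phi)}}{(\phi^{-1})!}\Big(\prod_{e\in E_\Lambda^+}\overline{\mathrm{Wg}}^{\mathrm O}_N(\mu_e(\phi))\Big)N^{\chi(\mathcal M)-n}.$$ The sum converges absolutely in the following sense: $$\sum_{K:\mathcal P\to\mathbb N}\Big|\sum_{(\mathcal M,\phi)\in\mathrm{EPE}_{\mathrm{OS}}(s,K)}\frac{\beta^{\mathrm{area}(\mathcal M,\phi)}}{(\phi^{-1})!}\Big(\prod_{e\in E_\Lambda^+}\overline{\mathrm{Wg}}^{\mathrm O}_N(\mu_e(\phi))\Big)N^{\chi(\mathcal M)-n}\Big|<\infty.$$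
   Context: Lattice Yang–Mills with gauge group $G=O(N)$: $\Lambda$ is a finite graph, $E_\Lambda^+$ contains one orientation of each edge. To each $e\in E_\Lambda^+$ is assigned $Q_e\in G$, with $Q_{e^{-1}}=Q_e^{-1}$; for a path $p=(e_1,\dots,e_k)$, $Q_p=Q_{e_1}\cdots Q_{e_k}$. A loop is a (nonempty) directed closed path up to cyclic reordering. $\mathcal P$ is a finite set of loops (plaquettes) closed under orientation reversal (usually directed unit squares). The measure is $Z_{\Lambda,\beta}^{-1}\prod_{p\in\mathcal P}\exp(N\beta\,\mathrm{Tr}(Q_p))\prod_{e\in E_\Lambda^+}dQ_e$, $dQ_e$ normalized Haar measure on $G$, $Z_{\Lambda,\beta}$ the normalizing constant. A string $s=(\ell_1,\dots,\ell_n)$ is a finite collection of loops; $W_s(Q)=\prod_i\frac1N\mathrm{Tr}(Q_{\ell_i})$ and $\langle W_s\rangle_{\Lambda,\beta}$ is its expectation. Orthogonal Weingarten function: for even $m$, consider matchings $\pi,\pi'$ of $[m]=\{1,\dots,m\}$ (partitions into two-element sets). $\#\mathrm{cycles}(\pi,\pi')$ is the number of connected components of the graph with $m$ strands, each having a left and a right vertex joined by the strand, where left vertices are joined according to $\pi$ and right vertices according to $\pi'$. For $\zeta\in\mathbb C$ (here $\zeta=N$ is real), let $\mathbf G(\pi,\pi')=\zeta^{\#\mathrm{cycles}(\pi,\pi')}$, and let $\mathrm{Wg}^{\mathrm O}_\zeta$ be the (Moore–Penrose) pseudo-inverse of the matrix $\mathbf G$, a symmetric matrix $W$ with $W\mathbf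 GW=W$, $\mathbf GW\mathbf G=\mathbf G$. Normalized version: $\overline{\mathrm{Wg}}^{\mathrm O}_\zeta(\pi,\pi')=\zeta^{m-\#\mathrm{cycles}(\pi,\pi')}\mathrm{Wg}^{\mathrm O}_\zeta(\pi,\pi')$. (For $m=0$ the value is $1$.) These depend only on the multiset of component sizes (numbers of strands) of the graph formed by the $m$ strands with left vertices joined according to $\pi$ and right vertices joined according to $\pi'$. The set $\mathrm{EPE}_{\mathrm{OS}}(s,K)$: given $K:\mathcal P\to\mathbb N$, let $\mathbf\Gamma(s,K)$ be the collection of words in the letters $E_\Lambda^+$ consisting of $\ell_1,\dots,\ell_n$ and, for each $p\in\mathcal P$, $K(p)$ copies of $p$. For each $e\in E_\Lambda^+$ let $n_e$ be the total number of occurrences of $e$ or $e^{-1}$. If some $n_e$ is odd then $\mathrm{EPE}_{\mathrm{OS}}(s,K)=\emptyset$. Otherwise, for every letter occurrence take a strand with a left and a right vertex; an occurrence of $e$ is traversed left to right, an occurrence of $e^{-1}$ right to left; label the strands of $e$ by $1,\dots,n_e$. For each family of pairs of matchings $\pi_e,\pi_e'$ of $[n_e]$, $e\in E_\Lambda^+$, a map is built: yellow faces are polygons, one for each word, whose boundary edges are the strands of the word in cyclic order (end vertex of each strand identified with start vertex of the next); blue faces at $e$ are obtained by joining left vertices according to $\pi_e$ and right vertices according to $\pi_e'$, each resulting component with $2a$ strands giving (after contracting the connections) a $2a$-gon with those strands as boundary edges. Each strand lies on exactly one yellow and one blue face; faces are glued along common strands to form a (possibly non-orientable) map. Delete the $n$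 yellow faces of $\ell_1,\dots,\ell_n$ to get $\mathcal M$, and let $\phi$ send each strand to the lattice edge it represents. $\mathrm{EPE}_{\mathrm{OS}}(s,K)$ is the set of pairs $(\mathcal M,\phi)$ so obtained, one for each choice of matchings (labelled objects), and $\mathrm{EPE}_{\mathrm{OS}}(s)=\bigsqcup_K\mathrm{EPE}_{\mathrm{OS}}(s,K)$. For $(\mathcal M,\phi)\in\mathrm{EPE}_{\mathrm{OS}}(s,K)$: $\mathrm{area}(\mathcal M,\phi)=\sum_pK(p)$; $(\phi^{-1})!=\prod_pK(p)!$; $\mu_e(\phi)$ is the multiset of half-degrees of the blue faces at $e$, and $\overline{\mathrm{Wg}}^{\mathrm O}_N(\mu_e(\phi))$ means $\overline{\mathrm{Wg}}^{\mathrm O}_N(\pi_e,\pi_e')$; $\chi(\mathcal M)$ is the Euler characteristic (vertices minus edges plus faces). *)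

(* Defs.v *)
From HB Require Import structures.
From mathcomp Require Import all_boot all_order all_algebra finmap.

Set Implicit Arguments.
Unset Strict Implicit.
Unset Printing Implicit Defensive.

Import Order.TTheory GRing.Theory Num.Theory.

(* [edge] is E^+, one orientation of each edge. *)
Record lattice := Lattice {
  vertex : finType;
  edge : finType;
  source : edge -> vertex;
  target : edge -> vertex }.

(* [(e, true)] stands for the edge e and [(e, false)] for e^-1. *)
Notation letter L := (edge L * bool)%type.

Section Loops.
Variable L : lattice.
Implicit Types (a : letter L) (w : seq (letter L)).

Definition start a : vertex L := if a.2 then source a.1 else target a.1.
Definition finish a : vertex L := if a.2 then target a.1 else source a.1.
Definition inv_letter a : letter L := (a.1, ~~ a.2).
Definition inv_word w := rev (map inv_letter w).

Definition is_closed_path w :=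
  (w != [::]) && cycle (fun a b => finish a == start b) w.

Definition closed_path := {w : seq (letter L) | is_closed_path w}.

Definition rot_eq (u v : closed_path) : bool :=
  [exists k : 'I_(size (val u)).+1, rot k (val u) == val v].

Lemma rot_eqP (u v : closed_path) :
  reflect (exists k, rot k (val u) = val v) (rot_eq u v).
Proof.
apply: (iffP existsP) => [[k /eqP uv]|[k uv]]; first by exists k.
have kP : minn k (size (val u)) < (size (val u)).+1 by rewrite ltnS geq_minr.
by exists (Ordinal kP); rewrite -rot_minn uv.
Qed.

Lemma rot_eq_refl : reflexive rot_eq.
Proof. by move=> u; apply/rot_eqP; exists 0; rewrite rot0. Qed.

Lemma rot_eq_sym : symmetric rot_eq.
Proof.
suff imp u v : rot_eq u v -> rot_eq v u by move=> u v; apply/idP/idP; apply: imp.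
move=> /rot_eqP[k uv]; apply/rot_eqP; exists (size (val v) - k).
by rewrite -uv -[rot _ _]/(rotr k (rot k (val u))) rotK.
Qed.

Lemma rot_eq_trans : transitive rot_eq.
Proof.
move=> v u w /rot_eqP[k uv] /rot_eqP[l vw]; apply/rot_eqP.
by exists (rot_add (val u) k l); rewrite -rot_rot_add uv vw.
Qed.

Canonical rot_eq_equiv := EquivRel rot_eq rot_eq_refl rot_eq_sym rot_eq_trans.

Definition loop := {eq_quot rot_eq_equiv}%qT.

Lemma inv_closed_path (u : closed_path) : is_closed_path (inv_word (val u)).
Proof.
case: u => w /= /andP[w0 cw]; apply/andP; split.
  by rewrite -size_eq0 size_rev size_map size_eq0.
rewrite rev_cycle cycle_map -(eq_cycle (e := fun a b => finish a == start b))//.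
by move=> [e b] [f c]; rewrite /= /start /finish /= !if_neg eq_sym.
Qed.

Definition inv_path (u : closed_path) : closed_path :=
  Sub (inv_word (val u)) (inv_closed_path u).

Definition word (l : loop) : seq (letter L) := val (repr l).

Definition inv_loop (l : loop) : loop := (\pi_loop (inv_path (repr l)))%qT.

End Loops.

Definition is_matching m (pi : {set {set 'I_m}}) :=
  partition pi [set: 'I_m] && [forall B in pi, #|B| == 2].

Definition matching m := {M : {set {set 'I_m}} | is_matching M}.

Definition components (T : finType) (e : rel T) : {set {set T}} :=
  equivalence_partition (connect e) [set: T].

(* [(i, false)] and [(i, true)] are the left and right vertices of strand i. *)
Definition strand_graph m (pi pi' : matching m) : rel ('I_m * bool) :=
  fun u v =>
    [|| u.1 == v.1,
        [&& ~~ u.2, ~~ v.2 & [set u.1; v.1] \in val pi] |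
        [&& u.2, v.2 & [set u.1; v.1] \in val pi']].

Definition ncycles m (pi pi' : matching m) : nat :=
  #|components (strand_graph pi pi')|.

(* A polygon is given by the set of its boundary edges. Faces of the two       *)
(* colours are kept apart, since a yellow and a blue polygon may have the same *)
(* boundary edges. *)
Record colored_map := ColoredMap {
  map_edge : finType;
  map_vertices : {set {set map_edge * bool}};
  map_yellow : {set {set map_edge}};
  map_blue : {set {set map_edge}} }.

Definition euler_char (M : colored_map) : int :=
  #|map_vertices M|%:Z - #|map_edge M|%:Z
    + (#|map_yellow M|%:Z + #|map_blue M|%:Z).

Section Gluing.
Variables (L : lattice) (G : seq (seq (letter L))).

Definition strand : finType := {i : 'I_(size G) & 'I_(size (nth [::] G i))}.

Definition strand_letter (x : strand) : letter L :=
  tnth (in_tuple (nth [::] G (tag x))) (tagged x).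

Definition strand_edge (x : strand) : edge L := (strand_letter x).1.

Definition next_strand (x : strand) : strand :=
  Tagged (fun i : 'I_(size G) => 'I_(size (nth [::] G i))) (ordS (tagged x)).

(* e is traversed from left to right, e^-1 from right to left. *)
Definition strand_start (x : strand) : strand * bool := (x, ~~ (strand_letter x).2).
Definition strand_end (x : strand) : strand * bool := (x, (strand_letter x).2).

Definition nocc (e : edge L) : nat := #|[set x | strand_edge x == e]|.

Definition strand_at (e : edge L) (i : 'I_(nocc e)) : strand := enum_val i.

(* The strands over e are labelled by ['I_(nocc e)] through [strand_at]; if   *)
(* some [nocc e] is odd, there is no such family. *)
Definition matching_family : finType :=
  {dffun forall e : edge L, matching (nocc e) * matching (nocc e)}.

Definition pi_left (F : matching_family) e : matching (nocc e) := (F e).1.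
Definition pi_right (F : matching_family) e : matching (nocc e) := (F e).2.

Definition joined e (pi : matching (nocc e)) (x y : strand) : bool :=
  [exists i, exists j, [&& x == strand_at i, y == strand_at j &
                          [set i; j] \in val pi]].

(* Corners identified by the yellow polygons (end of a strand with the start   *)
(* of the next one) and by the blue ones (contracted matching edges). *)
Definition yellow_glued (u v : strand * bool) : bool :=
  [exists x, (u == strand_end x) && (v == strand_start (next_strand x))].

Definition blue_glued (F : matching_family) (u v : strand * bool) : bool :=
  [exists e, [&& ~~ u.2, ~~ v.2 & joined (pi_left F e) u.1 v.1]
          || [&& u.2, v.2 & joined (pi_right F e) u.1 v.1]].

Definition glued (F : matching_family) : rel (strand * bool) := fun u v =>
  [|| yellow_glued u v, yellow_glued v u | blue_glued F u v].

Definition yellow_face (i : 'I_(size G)) : {set strand} := [set x | tag x == i].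

Definition blue_faces_at (F : matching_family) e : {set {set strand}} :=
  [set [set strand_at u.1 | u in C : {set 'I_(nocc e) * bool}]
     | C in components (strand_graph (pi_left F e) (pi_right F e))].

(* The first [n] words carry no yellow face. *)
Definition glued_map (n : nat) (F : matching_family) : colored_map :=
  ColoredMap
    (components (glued F))
    [set yellow_face i | i : 'I_(size G) & n <= i]
    (\bigcup_(e : edge L) blue_faces_at F e).

End Gluing.

Section EPE.
Variables (L : lattice) (P : {fset loop L}).
Implicit Types (s : seq (loop L)) (K : {ffun P -> nat}).

Definition Gamma s K : seq (seq (letter L)) :=
  map (@word L) s ++ flatten [seq nseq (K p) (word (val p)) | p <- enum {: P}].

(* The maps are labelled objects: one for each family of matchings. *)
Definition EPE s K : finType := matching_family (Gamma s K).

Definition EPE_map s K (F : EPE s K) : colored_map := glued_map (size s) F.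

Definition EPE_phi s K (F : EPE s K) : map_edge (EPE_map F) -> edge L :=
  @strand_edge L (Gamma s K).

Definition area s K (F : EPE s K) : nat := \sum_(p : P) K p.

Definition phi_factorial s K (F : EPE s K) : nat := \prod_(p : P) (K p)`!.

End EPE.

From mathcomp Require Import all_classical all_reals all_analysis.
Import numFieldNormedType.Exports.
Local Open Scope classical_set_scope.
Local Open Scope ring_scope.

Section PseudoInverse.
Variables (R : realType) (m n : nat).
Implicit Types (A : 'M[R]_(m, n)) (W : 'M[R]_(n, m)).

Definition is_mp_pinv A W :=
  [/\ A *m W *m A = A, W *m A *m W = W,
      (A *m W)^T = A *m W & (W *m A)^T = W *m A].

(* Moore-Penrose; [pinvmx] of the library is only a right pseudo-inverse on    *)
(* the row space. *)
Definition mp_pinv A : 'M[R]_(n, m) := xget 0 [set W | is_mp_pinv A W].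

Lemma is_mp_pinv_uniq A W W' : is_mp_pinv A W -> is_mp_pinv A W' -> W = W'.
Proof.
move=> [a1 a2 a3 a4] [b1 b2 b3 b4].
have e1 : A *m W = A *m W'.
  by rewrite -a3 -{1}b1 -(mulmxA (A *m W')) trmx_mul a3 b3 mulmxA a1.
have e2 : W *m A = W' *m A.
  by rewrite -a4 -{1}b1 -!mulmxA mulmxA trmx_mul b4 a4 -mulmxA (mulmxA A) a1.
by rewrite -a2 -mulmxA e1 mulmxA e2 b2.
Qed.

End PseudoInverse.

Section PseudoInverseExists.
Variable R : realType.

Lemma mulmx_trmx_eq0 m n (A : 'M[R]_(m, n)) : A *m A^T = 0 -> A = 0.
Proof.
move=> A0; apply/matrixP => i j; rewrite mxE.
have := congr1 (fun B : 'M[R]_m => B i i) A0; rewrite !mxE.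
under eq_bigr do rewrite mxE -expr2.
move=> /eqP; rewrite psumr_eq0; last by move=> k _; exact: sqr_ge0.
by move=> /allP/(_ j (mem_index_enum _)); rewrite sqrf_eq0 => /eqP.
Qed.

Lemma gram_unitmx m n (A : 'M[R]_(m, n)) : row_free A -> A *m A^T \in unitmx.
Proof.
move=> Afree; rewrite -row_free_unit -kermx_eq0; apply/eqP.
have kA : kermx (A *m A^T) *m A = 0.
  apply: mulmx_trmx_eq0.
  by rewrite trmx_mul mulmxA -(mulmxA _ A) mulmx_ker mul0mx.
by apply: (row_free_inj Afree); rewrite kA mul0mx.
Qed.

Lemma mp_pinvP m n (A : 'M[R]_(m, n)) : is_mp_pinv A (mp_pinv A).
Proof.
suff [W AW] : exists W, is_mp_pinv A W.
  exact: (@xgetPex _ 0 [set V | is_mp_pinv A V]) (ex_intro _ W AW).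
rewrite -(mulmx_base A).
have := row_base_free A; have := col_base_full A.
move: (col_base A) (row_base A) => C B Cfull Bfree.
have Bu : B *m B^T \in unitmx by exact: gram_unitmx.
have Cu : C^T *m C \in unitmx.
  rewrite -[X in _ *m X]trmxK; apply: gram_unitmx.
  by rewrite /row_free mxrank_tr.
exists (B^T *m invmx (B *m B^T) *m (invmx (C^T *m C) *m C^T)).
have BBi : B *m (B^T *m invmx (B *m B^T)) = 1%:M by rewrite mulmxA mulmxV.
have CCi : (invmx (C^T *m C) *m C^T) *m C = 1%:M by rewrite -mulmxA mulVmx.
set X := B^T *m _ in BBi *; set Y := _ *m C^T in CCi *.
have AXY : C *m B *m (X *m Y) = C *m Y by rewrite -mulmxA (mulmxA B) BBi mul1mx.
have XYA : X *m Y *m (C *m B) = X *m B by rewrite -mulmxA (mulmxA Y) CCi mul1mx.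
split.
- by rewrite AXY -mulmxA (mulmxA Y) CCi mul1mx.
- by rewrite XYA -mulmxA (mulmxA B) BBi mul1mx.
- by rewrite AXY /Y !trmx_mul trmxK trmx_inv trmx_mul trmxK mulmxA.
- by rewrite XYA /X !trmx_mul trmxK trmx_inv trmx_mul trmxK mulmxA.
Qed.

End PseudoInverseExists.

Section Weingarten.
Variables (R : realType) (zeta : R).

Definition gram_mx m : 'M[R]_#|{: matching m}| :=
  \matrix_(i, j) zeta ^+ ncycles (enum_val i) (enum_val j).

Definition Wg m (pi pi' : matching m) : R :=
  mp_pinv (gram_mx m) (enum_rank pi) (enum_rank pi').

Definition Wg_norm m (pi pi' : matching m) : R :=
  zeta ^ (m%:Z - (ncycles pi pi')%:Z) * Wg pi pi'.

End Weingarten.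

Section Orthogonal.
Variables (R : realType) (N : nat).

Record orthogonal_mx := Orthogonal {
  mx_of_orthogonal :> 'M[R]_N;
  _ : mx_of_orthogonal *m mx_of_orthogonal^T == 1%:M }.

HB.instance Definition _ := [isSub for mx_of_orthogonal].
HB.instance Definition _ := [Choice of orthogonal_mx by <:].

Lemma orthogonal_mulmxT (Q : orthogonal_mx) : Q *m Q^T = 1%:M.
Proof. exact/eqP/(valP Q). Qed.

Lemma orthogonal_mulTmx (Q : orthogonal_mx) : Q^T *m Q = 1%:M.
Proof. exact/mulmx1C/orthogonal_mulmxT. Qed.

Definition orthogonal1 : orthogonal_mx.
Proof. by exists 1%:M; rewrite trmx1 mulmx1. Defined.

Definition orthogonalM (P Q : orthogonal_mx) : orthogonal_mx.
Proof.
exists (P *m Q); rewrite trmx_mul mulmxA -(mulmxA (P : 'M[R]_N)).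
by rewrite orthogonal_mulmxT mulmx1 orthogonal_mulmxT.
Defined.

Definition orthogonalV (Q : orthogonal_mx) : orthogonal_mx.
Proof. by exists Q^T; rewrite trmxK orthogonal_mulTmx. Defined.

Lemma orthogonal_mulA : associative orthogonalM.
Proof. by move=> x y z; apply: val_inj; exact: mulmxA. Qed.

Lemma orthogonal_mul1 : left_id orthogonal1 orthogonalM.
Proof. by move=> x; apply: val_inj; exact: mul1mx. Qed.

Lemma orthogonal_mulr1 : right_id orthogonal1 orthogonalM.
Proof. by move=> x; apply: val_inj; exact: mulmx1. Qed.

Lemma orthogonal_mulV : left_inverse orthogonal1 orthogonalV orthogonalM.
Proof. by move=> x; apply: val_inj; exact: orthogonal_mulTmx. Qed.

Lemma orthogonal_mulrV : right_inverse orthogonal1 orthogonalV orthogonalM.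
Proof. by move=> x; apply: val_inj; exact: orthogonal_mulmxT. Qed.

HB.instance Definition _ := isGroup.Build orthogonal_mx orthogonal_mulA
  orthogonal_mul1 orthogonal_mulr1 orthogonal_mulV orthogonal_mulrV.
HB.instance Definition _ := isPointed.Build orthogonal_mx orthogonal1.
HB.instance Definition _ :=
  Topological.copy orthogonal_mx (initial_topology mx_of_orthogonal).

Definition borel_orthogonal := g_sigma_algebraType (@open orthogonal_mx).

(* On a compact group, the normalized Haar measure is the only left-invariant  *)
(* Borel probability measure. *)
Definition is_haar (mu : probability borel_orthogonal R) : Prop :=
  forall (g : orthogonal_mx) (A : set borel_orthogonal), measurable A ->
    mu ((fun h : orthogonal_mx => (g * h)%g) @^-1` A) = mu A.

End Orthogonal.

Section ProbabilityPower.
Context d (T : measurableType d) (R : realType).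

Definition tuple_cons n (x : T * n.-tuple T) : n.+1.-tuple T :=
  [tuple of x.1 :: x.2].

Lemma measurable_tuple_cons n : measurable_fun [set: T * n.-tuple T] (@tuple_cons n).
Proof. exact: measurable_cons. Qed.

HB.instance Definition _ n :=
  isMeasurableFun.Build _ _ _ _ (@tuple_cons n) (@measurable_tuple_cons n).

Fixpoint prob_pow (mu : probability T R) n : probability (n.-tuple T) R :=
  if n is m.+1
  then distribution (mu \x prob_pow mu m)%E (@tuple_cons m)
  else \d_([tuple] : 0.-tuple T).

End ProbabilityPower.

Section YangMills.
Variables (R : realType) (L : lattice) (P : {fset loop L}) (N : nat).
Variables (haar : probability (borel_orthogonal R N) R) (beta : R).
Implicit Types (s : seq (loop L)).

Definition configuration : Type := #|edge L|.-tuple (borel_orthogonal R N).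

Definition link (Q : configuration) (e : edge L) : orthogonal_mx R N :=
  tnth Q (enum_rank e).

Definition holonomy (Q : configuration) (w : seq (letter L)) : orthogonal_mx R N :=
  (\big[*%g/1]_(a <- w) if a.2 then link Q a.1 else (link Q a.1)^-1)%g.

(* Independent of the base point chosen by [word], the trace being cyclic. *)
Definition loop_trace (Q : configuration) (l : loop L) : R :=
  \tr (holonomy Q (word l)).

Definition haar_product := prob_pow haar #|edge L|.

Definition ym_weight (Q : configuration) : R :=
  \prod_(p : P) expR (N%:R * beta * loop_trace Q (val p)).

Definition partition_function : R :=
  \int[haar_product]_(Q in setT) ym_weight Q.

Definition wilson (s : seq (loop L)) (Q : configuration) : R :=
  \prod_(l <- s) (N%:R^-1 * loop_trace Q l).

Definition wilson_expectation s : R :=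
  partition_function^-1 *
    \int[haar_product]_(Q in setT) (wilson s Q * ym_weight Q).

End YangMills.

Section SurfaceSum.
Variables (R : realType) (L : lattice) (P : {fset loop L}) (N : nat) (beta : R).

(* The half-degrees of the blue faces at e are those of the pair of matchings  *)
(* at e, which determines the value of the Weingarten function. *)
Definition EPE_Wg s K (F : @EPE L P s K) : R :=
  \prod_(e : edge L) Wg_norm N%:R (pi_left F e) (pi_right F e).

Definition EPE_term s K (F : @EPE L P s K) : R :=
  beta ^+ area F / (phi_factorial F)%:R * EPE_Wg F
    * N%:R ^ (euler_char (EPE_map F) - (size s)%:Z).

Definition EPE_sum s (K : {ffun P -> nat}) : R :=
  \sum_(F : EPE s K) EPE_term F.

End SurfaceSum.

(* Meaningful for absolutely summable families only. *)
Definition usum (I : choiceType) (R : realType) (f : I -> R) : R :=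
  fine (\esum_(i in [set: I]) ((EFin \o f)^\+ i)%E
        - \esum_(i in [set: I]) ((EFin \o f)^\- i)%E)%E.

(* Main.v *)
Require Import Defs.
From mathcomp Require Import all_boot all_order all_algebra finmap.
From mathcomp Require Import ring lra.

(** Why the expansion holds.

    Expand every exponential of the Yang-Mills weight. The coefficient of the
    multiplicities K is an integral of a product of traces of words in
    independent Haar matrices (expansion_term, EPE_sumE). Writing each trace
    as a sum over an index for every corner of the yellow polygons
    (prod_trace_strand, sum_yellow_compatible), the integrand becomes a product,
    over the edges of the lattice, of monomials in the entries of one orthogonal
    matrix. The integral of such a monomial is a double sum over matchings of
    the left and of the right indices, weighted by the Weingarten function and
    by the condition that matched indices agree (haar_moment). Exchanging the
    sums, a family of matchings is left with its Weingarten weights and with the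
    number of index assignments that are constant on the corners it identifies,
    that is N to the number of vertices of the glued map
    (sum_yellow_prod_matching). The remaining powers of N only rewrite this
    exponent as an Euler characteristic: normalizing the Weingarten functions
    multiplies by N to the number of strands minus the number of blue faces
    (EPE_termE).

    The moments of Haar measure rest on invariant theory. As a function of its
    left indices, the tensor of moments is invariant under O(N), and it fixes
    the tensors of matchings. If the latter span the invariant tensors, then it
    is the orthogonal projection onto their span, which is B W B^T for W the
    pseudo-inverse of the Gram matrix of the columns of B
    (invariant_projection_Wg); this also covers the case where they are linearly
    dependent, and moments of odd degree, for which there is no matching.

    That they span is the first fundamental theorem for O(N), proved here by a
    Casimir argument (casimir_step, lie_invariant_eq0). An invariant tensor w
    orthogonal to all matchings has, by induction on its degree m, vanishing
    contractions. Invariance under the Lie algebra gives E_ab w = E_ba w for the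
    action of the matrix units, and then the sum over a, b of the squared norms
    of E_ab w, which is the sum of the inner products of E_ab w with E_ba w,
    equals m |w|^2 up to contractions. On the other hand, invariance under
    diagonal signs makes each letter occur an even number n_a of times in the
    support of w, so that the terms a = b alone contribute at least 2 m |w|^2.
    Hence w = 0 for m > 0.

    Finally, as the traces are bounded by N, the expansion is dominated by a
    product of exponential series. This gives summability in K and allows
    dominated convergence along the boxes of multiplicities less than n
    (summable_EPE_sum, cvg_sum_EPE_sum), whose limit is the unordered sum
    (cvg_box_usum). *)

Set Implicit Arguments.
Unset Strict Implicit.
Unset Printing Implicit Defensive.
Import Order.TTheory GRing.Theory Num.Theory.
Local Open Scope ring_scope.

(** * Invariant theory of O(N): a tensor killed by all contractions *)

Section Casimir.
Variables (R : realDomainType) (S U : finType).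
Implicit Types (J I : {ffun S -> U}) (A : {set S}) (w : {ffun S -> U} -> R).

Definition upd J k a : {ffun S -> U} := [ffun x => if x == k then a else J x].

(** The matrix unit E_ab of gl, acting as a derivation on the tensor factors in A. *)
Definition shift A a b w J : R := \sum_(k in A | J k == a) w (upd J k b).

Definition contract k l w J : R := \sum_d w (upd (upd J k d) l d).

(** Invariance under the matrices E_ab - E_ba, which span the Lie algebra of the
    orthogonal group. *)
Definition lie_invariant A w :=
  forall a b J, shift A a b w J = shift A b a w J.

(** This is what invariance under the diagonal matrices of signs gives. *)
Definition even_support A w :=
  forall J, w J != 0 -> forall a, ~~ odd #|[set k in A | J k == a]|.

Definition const_on (pi : {set {set S}}) I :=
  [forall x, forall y, ([set x; y] \in pi) ==> (I x == I y)].

Definition agree_off A J I := [forall x, (x \notin A) ==> (I x == J x)].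

(** The coordinates outside A are parameters, with the values that J gives them,
    so that the predicate still makes sense after a contraction has removed two
    coordinates from A. *)
Definition matching_orthogonal A w :=
  forall pi, partition pi A -> (forall B, B \in pi -> #|B| = 2%N) ->
  forall J, \sum_(I | agree_off A J I && const_on pi I) w I = 0.

Lemma upd_same J k a : upd J k a k = a.
Proof. by rewrite ffunE eqxx. Qed.

Lemma upd_other J k a x : x != k -> upd J k a x = J x.
Proof. by move=> /negPf xk; rewrite ffunE xk. Qed.

Lemma upd_id J k : upd J k (J k) = J.
Proof. by apply/ffunP => x; rewrite ffunE; case: eqP => // ->. Qed.

Lemma upd_upd J k a b : upd (upd J k a) k b = upd J k b.
Proof. by apply/ffunP => x; rewrite !ffunE; case: eqP. Qed.

Lemma updC J k l a b : k != l -> upd (upd J k a) l b = upd (upd J l b) k a.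
Proof.
move=> kl; apply/ffunP => x; rewrite !ffunE.
by case: (x =P l) => [->|//]; rewrite eq_sym (negPf kl).
Qed.

(** Exchanging p with the value of J at k is an involution of the pairs (J, p). *)
Lemma sum_upd (F : {ffun S -> U} -> R) k :
  \sum_J \sum_p F (upd J k p) = #|U|%:R * \sum_J F J.
Proof.
rewrite pair_big /= (reindex_inj (h := fun z => (upd z.1 k z.2, z.1 k))) /=; last first.
  apply: (can_inj (g := fun z => (upd z.1 k z.2, z.1 k))) => -[J p] /=.
  by rewrite upd_upd upd_id upd_same.
under eq_bigr do rewrite upd_upd upd_id.
rewrite -(pair_big predT predT (fun J _ => F J)) /= mulr_sumr.
by apply: eq_bigr => J _; rewrite sumr_const mulr_natl.
Qed.

(** The first factor does not depend on J k and the second does not depend on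
    J l: the sum over both letters is the square of an entry of the contraction. *)
Lemma sum_contract0 w k l : k != l -> (forall J, contract k l w J = 0) ->
  \sum_J w (upd J k (J l)) * w (upd J l (J k)) = 0.
Proof.
move=> kl cw0; have [U0|U0] := posnP #|U|.
  by rewrite big1 // => J _; have := card0_eq U0 (J k); rewrite inE.
apply/eqP; have /eqP := sum_upd (fun J => w (upd J k (J l)) * w (upd J l (J k))) k.
rewrite big1 => [|J _]; last first.
  under eq_bigr do rewrite upd_upd upd_same upd_other 1?eq_sym //.
  by rewrite -mulr_sumr [X in _ * X](cw0 J) mulr0.
by rewrite eq_sym mulf_eq0 pnatr_eq0 -leqn0 leqNgt U0.
Qed.

(** The letters a and b are forced to be those of J at the factors k and l on
    which the two derivations act, so that the product over (a, b) and (b, a)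
    moves each of these letters to the place of the other. *)
Lemma sum_shift_shift A w :
  \sum_J \sum_a \sum_b shift A a b w J * shift A b a w J
  = \sum_(k in A) \sum_(l in A) \sum_J w (upd J k (J l)) * w (upd J l (J k)).
Proof.
transitivity (\sum_J \sum_(k in A) \sum_(l in A)
    w (upd J k (J l)) * w (upd J l (J k))).
  apply: eq_bigr => J _.
  transitivity (\sum_a \sum_b \sum_(k in A | J k == a) \sum_(l in A | J l == b)
      w (upd J k (J l)) * w (upd J l (J k))).
    apply: eq_bigr => a _; apply: eq_bigr => b _.
    rewrite mulr_suml; apply: eq_bigr => k /andP[_ /eqP <-].
    by rewrite mulr_sumr; apply: eq_bigr => l /andP[_ /eqP <-].
  rewrite (partition_big (fun k => J k) predT) //=; apply: eq_bigr => a _.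
  rewrite exchange_big /=; apply: eq_bigr => k _.
  by rewrite [RHS](partition_big (fun l => J l) predT).
rewrite exchange_big /=; apply: eq_bigr => k _.
by rewrite exchange_big.
Qed.

Lemma sum_card_fiber A J : \sum_a #|[set k in A | J k == a]| = #|A|.
Proof.
rewrite -sum1_card (partition_big (fun k => J k) predT) //=.
by apply: eq_bigr => a _; rewrite -sum1_card; apply: eq_bigl => k; rewrite inE.
Qed.

(** By Lie invariance, the sum of the squares of E_ab w is the sum of the
    products of E_ab w and E_ba w. When the contractions vanish, only the terms
    k = l of [sum_shift_shift] survive, and they give #|A| times the squared norm
    of w. But E_aa multiplies w J by the number n_a of occurrences of a, and
    n_a ^ 2 >= 2 n_a as n_a is even: the squares of the E_aa w already amount to
    twice as much. *)
Lemma casimir_step A w : A != set0 -> lie_invariant A w -> even_support A w ->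
  (forall k l, k \in A -> l \in A -> k != l -> forall J, contract k l w J = 0) ->
  forall J, w J = 0.
Proof.
move=> A0 wL wE wC; have wA : \sum_J \sum_a \sum_b (shift A a b w J) ^+ 2
    = #|A|%:R * \sum_J w J ^+ 2.
  transitivity (\sum_J \sum_a \sum_b shift A a b w J * shift A b a w J).
    by do 3!apply: eq_bigr => ? _; rewrite expr2 [X in _ * X]wL.
  rewrite sum_shift_shift mulr_natl -sumr_const; apply: eq_bigr => k kA.
  rewrite (bigD1 k) //= [X in _ + X]big1 => [|l /andP[lA lk]]; last first.
    by apply: sum_contract0; [rewrite eq_sym|apply: wC; rewrite // eq_sym].
  by rewrite addr0; apply: eq_bigr => J _; rewrite upd_id expr2.
have diag J : (2 * #|A|)%:R * w J ^+ 2 <= \sum_a \sum_b (shift A a b w J) ^+ 2.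
  have [->|wJ] := eqVneq (w J) 0.
    by rewrite expr0n mulr0 sumr_ge0 // => a _; rewrite sumr_ge0 // => b _; exact: sqr_ge0.
  (* The terms a != b are dropped; E_aa has the eigenvalue n_a at J. *)
  apply: (@le_trans _ _ (\sum_a (#|[set k in A | J k == a]| ^ 2)%:R * w J ^+ 2)).
    rewrite -mulr_suml ler_wpM2r ?sqr_ge0 // -natr_sum ler_nat.
    rewrite -(sum_card_fiber A J) big_distrr /= leq_sum // => a _.
    by have := wE _ wJ a; case: #|_| => [|[|n]] // _; rewrite -mulnn leq_mul2r orbT.
  apply: ler_sum => a _; rewrite (bigD1 a) //=.
  rewrite (_ : shift A a a w J = #|[set k in A | J k == a]|%:R * w J); last first.
    rewrite /shift mulr_natl -sumr_const; apply: eq_big => [k|k]; first by rewrite inE.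
    by move=> /andP[_ /eqP <-]; rewrite upd_id.
  by rewrite exprMn natrX lerDl sumr_ge0 // => b _; exact: sqr_ge0.
have le2 : (2 * #|A|)%:R * \sum_J w J ^+ 2 <= #|A|%:R * \sum_J w J ^+ 2.
  by rewrite -wA mulr_sumr ler_sum.
have w2_ge0 : 0 <= \sum_J w J ^+ 2 by apply: sumr_ge0 => J _; exact: sqr_ge0.
have A_gt0 : (0 : R) < #|A|%:R by rewrite ltr0n card_gt0.
have /eqP : \sum_J w J ^+ 2 = 0.
  by apply/eqP; rewrite eq_le w2_ge0 andbT; move: le2; rewrite natrM; nra.
rewrite psumr_eq0 => [/allP w0 J|J _]; last exact: sqr_ge0.
by have /= := w0 J (mem_index_enum _); rewrite sqrf_eq0 => /eqP.
Qed.

Lemma shift_split A a b w k l J : k \in A -> l \in A -> k != l ->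
  shift A a b w J = (if J k == a then w (upd J k b) else 0)
    + (if J l == a then w (upd J l b) else 0) + shift (A :\ k :\ l) a b w J.
Proof.
move=> kA lA kl; rewrite /shift !big_mkcondr /=.
rewrite (bigD1 k) //= (bigD1 l) /=; last by rewrite lA eq_sym.
rewrite addrA; congr (_ + _); apply: eq_bigl => x; rewrite !inE.
by rewrite [RHS]andbC [X in X && _]andbC -andbA.
Qed.

(** The terms in which E_ab acts on k or on l become, once contracted, symmetric
    in a and b. *)
Lemma lie_invariant_contract A w k l : k \in A -> l \in A -> k != l ->
  lie_invariant A w -> lie_invariant (A :\ k :\ l) (contract k l w).
Proof.
move=> kA lA kl wL.
suff shiftC a b J : shift (A :\ k :\ l) a b (contract k l w) J
    = \sum_d shift A a b w (upd (upd J k d) l d)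
      - (w (upd (upd J k b) l a) + w (upd (upd J k a) l b)).
  move=> a b J; rewrite !shiftC; congr (_ - _); last exact: addrC.
  by apply: eq_bigr => d _; exact: wL.
under eq_bigr do rewrite (shift_split a b _ _ kA lA kl).
rewrite !big_split /=.
have ukb d : upd (upd (upd J k d) l d) k b = upd (upd J k b) l d.
  by rewrite -updC // upd_upd.
under eq_bigr do rewrite upd_other // upd_same ukb.
rewrite -big_mkcond big_pred1_eq.
under [X in _ + X + _]eq_bigr do rewrite upd_same upd_upd.
rewrite -big_mkcond big_pred1_eq [RHS]addrAC subrr add0r.
rewrite /shift /contract exchange_big /=; apply: eq_bigr => d _.
apply: eq_big => [x|x]; rewrite !inE.
  by case: (x =P l) => //= /eqP xl; case: (x =P k) => //= /eqP xk; rewrite !upd_other.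
move=> /andP[/and3P[xl xk _] _]; congr (w _).
by rewrite [in RHS]updC 1?eq_sym // [upd (upd J k d) x b]updC // eq_sym.
Qed.

(** The letter that the contraction puts at k and at l is counted twice. *)
Lemma even_support_contract A w k l : k \in A -> l \in A -> k != l ->
  even_support A w -> even_support (A :\ k :\ l) (contract k l w).
Proof.
move=> kA lA kl wE J cJ a.
have [d wd] : exists d, w (upd (upd J k d) l d) != 0.
  apply/existsP; rewrite -negb_forall; apply: contra cJ => /forallP c0.
  by apply/eqP; apply: big1 => d _; apply/eqP.
have := wE _ wd a; rewrite (cardsD1 k) inE kA (cardsD1 l) !inE lA [l == k]eq_sym (negPf kl).
rewrite upd_other // !upd_same /= !oddD !oddb addbA addbb addFb.
congr (~~ odd _); apply: eq_card => x; rewrite !inE.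
case: (x =P l) => //= /eqP xl; case: (x =P k) => //= /eqP xk.
by rewrite !upd_other.
Qed.

(** Contracting k with l and then along pi' is contracting along the matching
    pi' enlarged by the pair {k, l}. *)
Lemma matching_orthogonal_contract A w k l : k \in A -> l \in A -> k != l ->
  matching_orthogonal A w -> matching_orthogonal (A :\ k :\ l) (contract k l w).
Proof.
move=> kA lA kl wM pi' pi'P pi'2 J.
pose A' := A :\ k :\ l.
have A'E : A = [set k; l] :|: A'.
  apply/setP => x; rewrite !inE; case: (x =P k) => [->|_]; first by rewrite kA.
  by case: (x =P l) => [->|].
pose pi := [set k; l] |: pi'.
have piP : partition pi A.
  rewrite A'E; apply: partitionU1 => //.
    by apply/set0Pn; exists k; rewrite !inE eqxx.
  rewrite -setI_eq0; apply/eqP/setP => x; rewrite !inE.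
  by case: (x =P k) => //; case: (x =P l).
have pi2 B : B \in pi -> #|B| = 2%N.
  by rewrite !inE => /orP[/eqP ->|/pi'2 //]; rewrite cards2 kl.
rewrite -[RHS](wM pi piP pi2 J) /contract pair_big_dep /=.
rewrite [RHS](reindex_onto (fun z => upd (upd z.1 k z.2) l z.2)
  (fun I => (upd (upd I k (J k)) l (J l), I k))) /=; last first.
  move=> I /andP[_ /forallP/(_ k)/forallP/(_ l)/implyP kl_I].
  have /eqP IkIl : I k == I l by apply: kl_I; rewrite !inE eqxx.
  by apply/ffunP => x; rewrite !ffunE; case: (x =P l) => [->|_] //; case: (x =P k) => [->|].
apply: eq_bigl => -[I d] /=; rewrite andbT.
have notin x y : [set x; y] \in pi' -> [&& x != k, x != l, y != k & y != l].
  move=> xy; have : [set x; y] \subset A'.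
    by rewrite /A'; have /and3P[/eqP <- _ _] := pi'P; rewrite /cover (bigcup_max [set x; y]).
  rewrite subUset !sub1set !inE => /andP[/and3P[-> -> _] /and3P[-> -> _]].
  by [].
apply/andP/andP => [[/forallP Ia /forallP Ic]|[/andP[/forallP Ia /forallP Ic] /eqP[Ieq _]]].
- split; first (apply/andP; split).
  + apply/forallP => x; apply/implyP => xA; have := Ia x.
    rewrite !inE (negPf xA) !andbF /= => /eqP <-; rewrite !upd_other //.
      by apply: contraNneq xA => ->.
    by apply: contraNneq xA => ->.
  + apply/forallP => x; apply/forallP => y; apply/implyP; rewrite !inE => /orP[|xy].
      move=> /eqP xy; have : x \in [set k; l] by rewrite -xy !inE eqxx.
      have : y \in [set k; l] by rewrite -xy !inE eqxx orbT.
      by rewrite !inE !ffunE => /orP[]/eqP -> /orP[]/eqP ->; rewrite ?eqxx //;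
         rewrite ?(negPf kl) // ?[l == k]eq_sym ?(negPf kl).
    have /and4P[? ? ? ?] := notin _ _ xy; rewrite !upd_other //.
    by have /forallP/(_ y)/implyP := Ic x; apply.
  + apply/eqP; congr (_, _); last by rewrite upd_other // upd_same.
    have := Ia k; have := Ia l; rewrite !inE !eqxx /= andbF /= => /eqP Il /eqP Ik.
    by apply/ffunP => x; rewrite !ffunE; case: (x =P l) => [->|_] //; case: (x =P k) => [->|].
- split.
  + apply/forallP => x; apply/implyP; rewrite !inE !negb_and !negbK.
    rewrite -Ieq !ffunE; case: (x =P l) => [->|/eqP xl /=]; first by rewrite eqxx.
    case: (x =P k) => [->|/eqP xk /= xA]; first by rewrite eqxx.
    by have := Ia x; rewrite xA /= !upd_other.
  + apply/forallP => x; apply/forallP => y; apply/implyP => xy.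
    have := forallP (Ic x) y; rewrite !inE xy orbT /=.
    by have /and4P[? ? ? ?] := notin _ _ xy; rewrite !upd_other.
Qed.

(** Induction on A: the contractions of w vanish by the induction hypothesis, and
    for A empty the only matching is empty, whose sum is the single term w J. *)
Theorem lie_invariant_eq0 A w : lie_invariant A w -> even_support A w ->
  matching_orthogonal A w -> forall J, w J = 0.
Proof.
have [n] := ubnP #|A|; elim: n A w => // n IH A w; rewrite ltnS => An wL wE wM.
have [A0|A0] := eqVneq A set0; last first.
  apply: (casimir_step A0 wL wE) => k l kA lA kl.
  apply: (IH (A :\ k :\ l)); last 3 first.
  - exact: lie_invariant_contract.
  - exact: even_support_contract.
  - exact: matching_orthogonal_contract.
  apply: leq_trans An; apply: (@leq_ltn_trans #|A :\ k|).
    by apply: subset_leq_card; exact: subD1set.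
  by rewrite [X in (_ < X)%N](cardsD1 k) kA.
move=> J; rewrite -[RHS](wM set0 _ _ J); last 2 first.
- by rewrite A0 partition_set0.
- by move=> B; rewrite inE.
rewrite (big_pred1 J) // => I /=; apply/andP/eqP => [[/forallP IJ _]|->].
  by apply/ffunP => x; have := IJ x; rewrite A0 inE => /eqP.
split; apply/forallP => x; first by rewrite eqxx implybT.
by apply/forallP => y; rewrite inE.
Qed.

End Casimir.

(** * From the orthogonal group to its Lie algebra *)

Section PolyFacts.
Variable R : realFieldType.

Lemma poly_eq0_horner (p : {poly R}) : (forall t, p.[t] = 0) -> p = 0.
Proof.
move=> p0; apply/eqP; apply: contraT => pn0.
have := max_poly_roots (rs := [seq i%:R | i <- iota 0 (size p)]) pn0.
rewrite size_map size_iota ltnn; apply.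
  by apply/allP => x _; rewrite /root p0.
by rewrite map_inj_uniq ?iota_uniq // => i j /eqP; rewrite eqr_nat => /eqP.
Qed.

Lemma deriv_prod (T : finType) (p : T -> {poly R}) :
  (\prod_x p x)^`() = \sum_x (p x)^`() * \prod_(y | y != x) p y.
Proof.
have := index_enum_uniq T.
elim: (index_enum T) => [|x r IH] /=; first by rewrite !big_nil derivC.
move=> /andP[xr r_uniq]; rewrite !big_cons derivM IH // eqxx /=.
have rE z : z \in r -> z != x by move=> zr; apply: contraNneq xr => <-.
congr (_ * _ + _).
  by rewrite big_seq [RHS]big_seq_cond; apply: eq_bigl => y; case yr: (y \in r); rewrite //= rE.
rewrite mulr_sumr big_seq [RHS]big_seq; apply: eq_bigr => y yr.
by rewrite big_cons [x == y]eq_sym (negPf (rE _ yr)) /= mulrCA.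
Qed.

End PolyFacts.

Section Invariance.
Variables (R : realFieldType) (S : finType) (N : nat).
Implicit Types (I J : {ffun S -> 'I_N}) (w : {ffun S -> 'I_N} -> R).

Definition orth_invariant w := forall g : 'M[R]_N, g *m g^T = 1%:M ->
  forall I, \sum_(J : {ffun S -> 'I_N}) (\prod_x g (I x) (J x)) * w J = w I.

Lemma prod_delta I J : \prod_x (I x == J x)%:R = (I == J)%:R :> R.
Proof.
have [->|/eqP IJ] := altP eqP; first by rewrite big1 // => x _; rewrite eqxx.
have [x Ix] : exists x, I x != J x.
  apply/existsP; rewrite -negb_forall; apply/negP => /forallP IJx.
  by case: IJ; apply/ffunP => x; apply/eqP.
by rewrite (bigD1 x) //= (negPf Ix) mul0r.
Qed.

Lemma sum_delta_but x (F : {ffun S -> 'I_N} -> R) I :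
  \sum_(J : {ffun S -> 'I_N}) F J * \prod_(y | y != x) (I y == J y)%:R = \sum_c F (upd I x c).
Proof.
have delta J : \prod_(y | y != x) (I y == J y)%:R = (J == upd I x (J x))%:R :> R.
  rewrite -prod_delta [RHS](bigD1 x) //= upd_same eqxx mul1r.
  by apply: eq_bigr => y yx; rewrite upd_other // eq_sym.
under eq_bigr do rewrite delta mulr_natr mulrb.
rewrite -big_mkcond /= (reindex_onto (fun c => upd I x c) (fun J => J x)) /=; last first.
  by move=> J /eqP <-.
by apply: eq_bigl => c; rewrite !upd_same !eqxx.
Qed.

(** The reflection in the coordinate a multiplies the entry at J by -1 for each
    occurrence of a in J. *)
Lemma orth_invariant_even w : orth_invariant w -> even_support setT w.
Proof.
move=> wI J wJ a; pose v : 'rV[R]_N := \row_i (if i == a then -1 else 1).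
have vv : diag_mx v *m (diag_mx v)^T = 1%:M.
  rewrite tr_diag_mx mulmx_diag -diag_const_mx; congr diag_mx.
  by apply/rowP => i; rewrite !mxE; case: ifP; rewrite ?mulrNN mulr1.
have := wI _ vv J; rewrite (bigD1 J) //= [X in _ + X]big1 => [|I IJ]; last first.
  suff -> : \prod_x diag_mx v (J x) (I x) = 0 by rewrite mul0r.
  transitivity (\prod_x (v 0 (J x) * (J x == I x)%:R)).
    by apply: eq_bigr => x _; rewrite mxE mulr_natr.
  by rewrite big_split /= prod_delta eq_sym (negPf IJ) mulr0.
rewrite addr0 (_ : \prod_x _ = (-1) ^+ #|[set k in setT | J k == a]|).
  move=> /eqP; rewrite -signr_odd -subr_eq0 -{2}[w J]mul1r -mulrBl mulf_eq0 (negPf wJ) orbF.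
  by case: odd => //=; rewrite expr1 -opprD oppr_eq0 -(natrD _ 1 1) pnatr_eq0.
rewrite -prodr_const [RHS]big_mkcond /=; apply: eq_bigr => x _.
by rewrite !mxE eqxx mulr1n inE in_setT.
Qed.

Section Rotation.
Variables a b : 'I_N.
Hypothesis ab : a != b.

Let D : 'M[R]_N := delta_mx a a + delta_mx b b.
Let K : 'M[R]_N := delta_mx a b - delta_mx b a.

Let DD : D *m D = D.
Proof.
by rewrite /D !(mulmxDl, mulmxDr) !mul_delta_mx_cond !eqxx [b == a]eq_sym (negPf ab) !addr0 add0r.
Qed.

Let DK : D *m K = K.
Proof.
rewrite /D /K !(mulmxDl, mulmxDr, mulmxN, mulNmx) !mul_delta_mx_cond !eqxx
  [b == a]eq_sym (negPf ab).
by rewrite !mulr0n !mulr1n !(addr0, add0r, subr0, oppr0, opprK, opprD) // addrC.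
Qed.

Let KD : K *m D = K.
Proof.
rewrite /D /K !(mulmxDl, mulmxDr, mulmxN, mulNmx) !mul_delta_mx_cond !eqxx
  [b == a]eq_sym (negPf ab).
by rewrite !mulr0n !mulr1n !(addr0, add0r, subr0, oppr0, opprK, opprD) // addrC.
Qed.

Let KK : K *m K = - D.
Proof.
rewrite /D /K !(mulmxDl, mulmxDr, mulmxN, mulNmx) !mul_delta_mx_cond !eqxx
  [b == a]eq_sym (negPf ab).
by rewrite !mulr0n !mulr1n !(addr0, add0r, subr0, oppr0, opprK, opprD) // addrC.
Qed.

Let DT : D^T = D. Proof. by rewrite /D linearD /= !trmx_delta. Qed.
Let KT : K^T = - K. Proof. by rewrite /K linearB /= !trmx_delta opprB. Qed.

(** (1 + t^2) times the rotation by the angle 2 arctan t in the plane of a and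
    b, whose entries are polynomials in t. *)
Definition rotation_poly i j : {poly R} :=
  (i == j)%:R%:P * (1 + 'X^2) - (2 * D i j)%:P * 'X^2 + (2 * K i j)%:P * 'X.

Lemma rotation_orthogonal (t : R) :
  let g := (1 + t ^+ 2)^-1 *: \matrix_(i, j) (rotation_poly i j).[t] in
  g *m g^T = 1%:M.
Proof.
have t0 : 1 + t ^+ 2 != 0 by apply: lt0r_neq0; have := sqr_ge0 t; lra.
pose M := (1 + t ^+ 2) *: (1%:M : 'M[R]_N) - (2 * t ^+ 2) *: D + (2 * t) *: K.
rewrite /= (_ : \matrix_(i, j) _ = M); last first.
  rewrite /M /rotation_poly; move: D K => D' K'; apply/matrixP => i j.
  by rewrite !mxE !(hornerD, hornerN, hornerM, hornerC, hornerXn, hornerX);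
    move: ((i == j)%:R : R) (D' i j) (K' i j) => c d k; ring.
rewrite linearZ /= -scalemxAl -scalemxAr scalerA.
suff -> : M *m M^T = ((1 + t ^+ 2) * (1 + t ^+ 2)) *: 1%:M.
  by rewrite scalerA (_ : _ * _ = 1) ?scale1r //; field.
have -> : M^T = (1 + t ^+ 2) *: 1%:M - (2 * t ^+ 2) *: D - (2 * t) *: K.
  by rewrite /M linearD /= linearB /= !linearZ /= trmx1 DT KT scalerN.
rewrite /M.
rewrite !(mulmxDl, mulmxDr, mulNmx, mulmxN) -!scalemxAl -!scalemxAr.
rewrite !(mul1mx, mulmx1) DD DK KD KK.
move: D K => D' K'; apply/matrixP => i j; rewrite !mxE.
by move: ((i == j)%:R : R) (D' i j) (K' i j) => c d k; ring.
Qed.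

End Rotation.

(** Invariance under the rotations of the plane of a and b is, after clearing
    denominators, an identity between polynomials in t, whose derivative at 0 is
    the invariance under E_ab - E_ba. *)
Lemma orth_invariant_lie w : orth_invariant w -> lie_invariant setT w.
Proof.
move=> wI a b I; have [->//|ab] := eqVneq a b.
pose p := \sum_(J : {ffun S -> 'I_N}) (\prod_x rotation_poly a b (I x) (J x)) * (w J)%:P
          - (1 + 'X^2) ^+ #|S| * (w I)%:P.
have p0 : p = 0.
  apply: poly_eq0_horner => t; have := wI _ (rotation_orthogonal ab t) I.
  have t0 : 1 + t ^+ 2 != 0 by apply: lt0r_neq0; have := sqr_ge0 t; lra.
  move=> gI; rewrite /p hornerD hornerN horner_sum; apply/eqP; rewrite subr_eq0; apply/eqP.
  rewrite hornerM horner_exp hornerC hornerD hornerC hornerXn -gI mulr_sumr.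
  apply: eq_bigr => J _; rewrite hornerM horner_prod hornerC mulrA; congr (_ * _).
  rewrite -prodr_const -big_split /=; apply: eq_bigr => x _.
  by rewrite !mxE mulrA divff // mul1r.
have rot0 i j : (rotation_poly a b i j).[0] = (i == j)%:R.
  rewrite /rotation_poly !(hornerD, hornerN, hornerM, hornerC, hornerXn, hornerX).
  by rewrite ?expr0n /= !(mulr0, subr0, addr0, mulr1).
have rot1 i j : (rotation_poly a b i j)^`().[0] =
    2 * (((i == a) && (j == b))%:R - ((i == b) && (j == a))%:R).
  rewrite /rotation_poly !derivE
    !(hornerD, hornerN, hornerM, hornerC, hornerXn, hornerX, hornerMn) !mxE.
  by rewrite ?expr1 ?mul0rn !(mulr0, mul0r, addr0, add0r, subr0, oppr0, mulr1).
have := congr1 (fun q => (q^`()).[0]) p0.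
rewrite /p derivB linear_sum /= linear0 hornerC hornerD hornerN horner_sum.
under eq_bigr => J _.
  rewrite derivM derivC mulr0 addr0 hornerM hornerC deriv_prod horner_sum mulr_suml.
  under eq_bigr => x _.
    rewrite hornerM horner_prod rot1.
    under eq_bigr do rewrite rot0.
    rewrite mulrAC.
    over.
  over.
rewrite exchange_big /=; under eq_bigr => x _.
  rewrite (sum_delta_but x (fun J =>
    2 * (((I x == a) && (J x == b))%:R - ((I x == b) && (J x == a))%:R) * w J)).
  under eq_bigr do rewrite upd_same -mulrA mulrBl.
  rewrite -mulr_sumr sumrB (bigD1 b) //= big1 => [|c /negPf cb]; last by rewrite cb andbF mul0r.
  rewrite [X in _ - X](bigD1 a) //= [X in _ - (_ + X)]big1 => [|c /negPf ca];
    last by rewrite ca andbF mul0r.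
  rewrite !eqxx !andbT !addr0.
  over.
rewrite -mulr_sumr sumrB derivM derivC mulr0 addr0 deriv_exp.
(* The right-hand side is even in t, so that its derivative at 0 vanishes. *)
have d0 : ((1 + 'X^2)^`() : {poly R}).[0] = 0.
  by rewrite derivD derivC derivXn add0r hornerMn hornerXn expr1 mul0rn.
rewrite hornerM hornerMn hornerM d0 mul0r mul0rn mul0r subr0 => /eqP.
rewrite mulf_eq0 pnatr_eq0 /= subr_eq0 => /eqP e.
have shiftT c d : shift setT c d w I = \sum_x (I x == c)%:R * w (upd I x d).
  rewrite /shift big_mkcond /=; apply: eq_bigr => x _.
  by rewrite in_setT /=; case: ifP; rewrite ?mul1r ?mul0r.
by rewrite !shiftT.
Qed.

Theorem orth_invariant_eq0 w : orth_invariant w -> matching_orthogonal setT w ->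
  forall J, w J = 0.
Proof.
move=> wI; apply: lie_invariant_eq0; first exact: orth_invariant_lie.
exact: orth_invariant_even.
Qed.

End Invariance.

(** * Matchings and connected components *)

Section Components.
Variables (T U : finType) (r : rel T).
Hypothesis r_sym : symmetric r.

Definition compatible (f : {ffun T -> U}) :=
  [forall x, forall y, r x y ==> (f x == f y)].

Lemma card_components : #|components r| = #|roots r|.
Proof.
have cS := sym_connect_sym r_sym.
pose cls x := [set y in [set: T] | connect r x y].
have -> : components r = [set cls x | x in roots r].
  apply/setP => C; apply/imsetP/imsetP => -[x _ ->]; last by exists x.
  exists (fingraph.root r x); first exact: roots_root.
  by apply/setP => y; rewrite !inE /=; apply: same_connect => //; exact: connect_root.
apply: card_in_imset => x y /eqP xr /eqP yr exy.
have : y \in cls x by rewrite exy !inE connect0.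
by rewrite !inE /= -(root_connect cS) => /eqP; rewrite xr yr.
Qed.

(** A compatible function is free on one representative of each component. *)
Lemma card_compatible : #|[set f | compatible f]| = (#|U| ^ #|components r|)%N.
Proof.
have cS := sym_connect_sym r_sym.
rewrite card_components -(card_sig (roots r)) -card_ffun.
pose h (g : {ffun {x | roots r x} -> U}) : {ffun T -> U} :=
  [ffun x => g (Sub (fingraph.root r x) (roots_root cS x))].
rewrite -(card_imset predT (f := h)) => [|g g' hg]; last first.
  apply/ffunP => -[x xr]; have := congr1 (fun f : {ffun T -> U} => f x) hg.
  rewrite !ffunE; suff -> : Sub (fingraph.root r x) (roots_root cS x) = exist _ x xr by [].
  by apply: val_inj => /=; apply/eqP.
apply: eq_card => f; rewrite inE; apply/idP/imsetP => [fc|[g _ ->]]; last first.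
  apply/forallP => x; apply/forallP => y; apply/implyP => xy.
  rewrite !ffunE; apply/eqP; congr (g _); apply: val_inj => /=.
  by apply/eqP; rewrite root_connect // connect1.
have froot x : f (fingraph.root r x) = f x.
  have /connectP[p xp ->] := connect_root r x.
  elim: p x xp => //= z p IH x /andP[xz zp]; rewrite IH //; apply/esym/eqP.
  by have /forallP/(_ z)/implyP := forallP fc x; apply.
by exists [ffun x => f (val x)] => //; apply/ffunP => x; rewrite !ffunE /= froot.
Qed.

End Components.


Section Matchings.
Variables (m : nat) (U : finType).
Implicit Types pi : matching m.

Lemma strand_graph_sym pi pi' : symmetric (strand_graph pi pi').
Proof.
move=> u v; rewrite /strand_graph eq_sym ![[set v.1; _]]setUC.
by rewrite andbCA [X in _ || (_ || X)]andbCA.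
Qed.

(** Both vertices of a strand carry the same index, so that an index for each
    strand is a compatible index for each vertex of the strand graph. *)
Lemma card_const_on pi pi' :
  #|[set J : {ffun 'I_m -> U} | const_on (val pi) J && const_on (val pi') J]|
  = (#|U| ^ ncycles pi pi')%N.
Proof.
rewrite -card_compatible; last exact: strand_graph_sym.
pose h (J : {ffun 'I_m -> U}) : {ffun 'I_m * bool -> U} := [ffun u => J u.1].
rewrite -(card_imset _ (f := h)) => [|J J' hJ]; last first.
  by apply/ffunP => i; have := congr1 (fun f : {ffun _} => f (i, true)) hJ; rewrite !ffunE.
apply: eq_card => f; rewrite inE; apply/imsetP/idP => [[J]|/forallP fc].
  rewrite inE => /andP[/forallP Jl /forallP Jr] ->.
  apply/forallP => u; apply/forallP => v; apply/implyP.
  rewrite !ffunE => /or3P[/eqP -> //|/and3P[_ _ uv]|/and3P[_ _ uv]].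
    by have /forallP/(_ v.1)/implyP := Jl u.1; apply.
  by have /forallP/(_ v.1)/implyP := Jr u.1; apply.
have fE i b : f (i, b) = f (i, true).
  have /forallP/(_ (i, true))/implyP/(_ _)/eqP := fc (i, b); apply.
  by rewrite /strand_graph /= eqxx.
exists [ffun i => f (i, true)]; last by apply/ffunP => -[i b]; rewrite !ffunE /= fE.
rewrite inE; apply/andP; split; apply/forallP => i; apply/forallP => j;
  apply/implyP => ij; rewrite !ffunE.
  rewrite -(fE i false) -(fE j false).
  by have /forallP/(_ (j, false))/implyP := fc (i, false); apply; rewrite /strand_graph /= ij orbT.
by have /forallP/(_ (j, true))/implyP := fc (i, true); apply; rewrite /strand_graph /= ij !orbT.
Qed.

End Matchings.

Section MatchingTensor.
Variables (R : realFieldType) (m N : nat).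
Implicit Types (I J : {ffun 'I_m -> 'I_N}) (pi : matching m).

Definition matching_tensor pi J : R := (const_on (val pi) J)%:R.

Lemma matchingP pi : partition (val pi) setT /\ forall B, B \in val pi -> #|B| = 2%N.
Proof.
have /andP[piP /forallP pi2] := valP pi; split=> // B Bpi.
by have := pi2 B; rewrite Bpi => /eqP.
Qed.

(** The sum over J constant on the pairs of pi factors into one sum
    sum_c g_{I k, c} g_{I l, c} = delta_{I k, I l} for each pair {k, l}. *)
Lemma matching_tensor_invariant pi : orth_invariant (matching_tensor pi).
Proof.
move=> g gg I; have [piP pi2] := matchingP pi.
have /and3P[/eqP cov triv n0] := piP.
have blkP x : pblock (val pi) x \in val pi by rewrite pblock_mem // cov in_setT.
pose blk x : {B | B \in val pi} := Sub (pblock (val pi) x) (blkP x).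
pose h (c : {ffun {B | B \in val pi} -> 'I_N}) : {ffun 'I_m -> 'I_N} := [ffun x => c (blk x)].
pose rep (B : {B | B \in val pi}) : 'I_m := xchoose (set0Pn _ (memPn n0 _ (valP B))).
have repP B : rep B \in val B by exact: xchooseP.
have blk_rep B : blk (rep B) = B.
  by apply: val_inj => /=; exact: def_pblock (valP B) (repP B).
have constP J : reflect (forall x y, blk x = blk y -> J x = J y) (const_on (val pi) J).
  apply: (iffP forallP) => [Jc x y xy|Jc x].
    have [->//|nxy] := eqVneq x y.
    have xyB : [set x; y] = val (blk x).
      apply/eqP; rewrite eqEcard cards2 nxy pi2 ?leqnn ?andbT; last exact: valP.
      rewrite subUset !sub1set {2}xy /= !mem_pblock cov.
      by rewrite !in_setT.
    by have /forallP/(_ y)/implyP/(_ _)/eqP := Jc x; apply; rewrite xyB; exact: valP.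
  apply/forallP => y; apply/implyP => xy; apply/eqP; apply: Jc; apply: val_inj => /=.
  by rewrite (def_pblock triv xy) ?(def_pblock triv xy) // !inE eqxx ?orbT.
transitivity (\sum_(J | const_on (val pi) J) \prod_x g (I x) (J x)).
  rewrite [RHS]big_mkcond /=; apply: eq_bigr => J _; rewrite /matching_tensor.
  by case: ifP; rewrite ?mulr1 ?mulr0.
rewrite (reindex_onto h (fun J => [ffun B => J (rep B)])) /=; last first.
  move=> J /constP Jc; apply/ffunP => x; rewrite !ffunE; apply: Jc.
  by rewrite blk_rep.
transitivity (\sum_(c : {ffun {B | B \in val pi} -> 'I_N})
    \prod_(B : {B | B \in val pi}) \prod_(x | blk x == B) g (I x) (c B)).
  apply: eq_big => [c|c _].
    apply/andP; split; first by apply/constP => x y xy; rewrite !ffunE xy.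
    by apply/eqP/ffunP => B; rewrite !ffunE blk_rep.
  rewrite (partition_big blk predT) //=; apply: eq_bigr => B _.
  by apply: eq_bigr => x /eqP <-; rewrite ffunE.
rewrite -(bigA_distr_bigA (fun (B : {B | B \in val pi}) c => \prod_(x | blk x == B) g (I x) c)) /=.
have pair B : \sum_c \prod_(x | blk x == B) g (I x) c =
    [forall x, forall y, (blk x == B) && (blk y == B) ==> (I x == I y)]%:R.
  have /eqP/cards2P[k [l [kl Bkl]]] := pi2 _ (valP B).
  have blkE x : (blk x == B) = (x \in [set k; l]).
    rewrite -Bkl; apply/eqP/idP => [<-|xB]; first by rewrite /= mem_pblock cov in_setT.
    by apply: val_inj => /=; exact: def_pblock (valP B) xB.
  under eq_bigr => c _.
    rewrite (eq_bigl _ _ blkE) big_setU1 ?inE //= big_set1.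
    over.
  have := congr1 (fun M : 'M_N => M (I k) (I l)) gg; rewrite !mxE => gkl.
  transitivity ((I k == I l)%:R : R).
    by rewrite -gkl; apply: eq_bigr => c _; rewrite mxE.
  congr (nat_of_bool _)%:R; apply/eqP/forallP => [Ikl x|Ic].
    apply/forallP => y; rewrite !blkE !inE; apply/implyP.
    by move=> /andP[/orP[]/eqP -> /orP[]/eqP ->]; rewrite ?Ikl.
  by have /forallP/(_ l) := Ic k; rewrite !blkE !inE !eqxx orbT => /eqP.
under eq_bigr do rewrite pair.
rewrite /matching_tensor; case: constP => [Ic|nIc].
  rewrite big1 // => B _; rewrite (_ : [forall x, _]) //.
  apply/forallP => x; apply/forallP => y; apply/implyP => /andP[/eqP xB /eqP yB].
  by apply/eqP/Ic; rewrite xB yB.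
suff /existsP[B /negPf nB] : [exists B : {B | B \in val pi},
    ~~ [forall x, forall y, (blk x == B) && (blk y == B) ==> (I x == I y)]].
  by apply/eqP/prodf_eq0; exists B; [exact: isT | rewrite nB].
rewrite -negb_forall; apply/negP => /forallP all; case: nIc => x y xy.
have /forallP/(_ x)/forallP/(_ y) := all (blk y).
by rewrite xy eqxx => /eqP.
Qed.

(** The first fundamental theorem of invariant theory for O(N), in dual form: the
    matching tensors span the invariant ones. *)
Theorem orth_invariant_eq0_matching (w : {ffun 'I_m -> 'I_N} -> R) :
  orth_invariant w -> (forall pi, \sum_I matching_tensor pi I * w I = 0) ->
  forall J, w J = 0.
Proof.
move=> wI wM; apply: orth_invariant_eq0 => // P PP P2 J.
have PM : is_matching P.
  by rewrite /is_matching PP; apply/forallP => C; apply/implyP => /P2 ->.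
rewrite -[RHS](wM (Sub P PM)) big_mkcond /=; apply: eq_bigr => I _.
rewrite /matching_tensor /= (_ : agree_off _ _ _).
  by case: const_on; rewrite ?mul1r ?mul0r.
by apply/forallP => x; rewrite in_setT.
Qed.

End MatchingTensor.

(** * Traces of words as sums over index assignments *)

Section DependentDistributivity.
Variables (R : comPzSemiRingType) (I : finType) (T : I -> finType).

Lemma prod_sum_fprod (F : forall i, T i -> R) :
  \prod_i \sum_j F i j = \sum_(t : fprod T) \prod_i F i (t i).
Proof.
pose F' i := [ffun j => F i j].
transitivity (\prod_i \sum_(j : T i) F' i j).
  by apply: eq_bigr => i _; apply: eq_bigr => j _; rewrite ffunE.
transitivity (\sum_(t : fprod T) \prod_(i in I) F' i (t i)); last first.
  by apply: eq_bigr => t _; apply: eq_bigr => i _; rewrite ffunE.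
under eq_bigr do rewrite (big_tag (fun i j => F' i j)).
by rewrite bigA_distr_big_dep /= -(big_fprod _ _ F').
Qed.

Lemma prod_sum_dffun (F : forall i, T i -> R) :
  \prod_i \sum_j F i j = \sum_(f : {dffun forall i, T i}) \prod_i F i (f i).
Proof.
rewrite prod_sum_fprod (reindex _ (onW_bij _ (@fprod_of_dffun_bij _ T))) /=.
by apply: eq_bigr => f _; apply: eq_bigr => i _; rewrite fprodE.
Qed.

End DependentDistributivity.

Lemma prod_sum_ffun_sigma (R : comPzSemiRingType) (I : finType) (T : I -> finType)
    (U : finType) (F : forall i, {ffun T i -> U} -> R) :
  \prod_i \sum_f F i f
  = \sum_(f : {ffun {i : I & T i} -> U}) \prod_i F i [ffun k => f (Tagged T k)].
Proof.
rewrite (prod_sum_fprod (T := fun i => {ffun T i -> U})).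
pose h (f : {ffun {i : I & T i} -> U}) : fprod (fun i => {ffun T i -> U}) :=
  [fprod i => [ffun k => f (Tagged T k)]].
rewrite (reindex h) /=.
  by apply: eq_bigr => f _; apply: eq_bigr => i _; rewrite fprodE.
apply: onW_bij; exists (fun t : fprod (fun i => {ffun T i -> U}) =>
  [ffun x => t (tag x) (tagged x)]).
  by move=> f; apply/ffunP => -[i k]; rewrite !ffunE fprodE ffunE.
by move=> t; apply/fprodP => i; rewrite fprodE; apply/ffunP => k; rewrite !ffunE.
Qed.

Section TraceOfWord.
Variables (R : comPzRingType) (N : nat).

Definition ffun_cons n (a : 'I_N) (f : {ffun 'I_n -> 'I_N}) : {ffun 'I_n.+1 -> 'I_N} :=
  [ffun k => if unlift ord0 k is Some k' then f k' else a].

Lemma ffun_cons0 n a (f : {ffun 'I_n -> 'I_N}) : ffun_cons a f ord0 = a.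
Proof. by rewrite ffunE unlift_none. Qed.

Lemma ffun_cons_lift n a (f : {ffun 'I_n -> 'I_N}) k : ffun_cons a f (lift ord0 k) = f k.
Proof. by rewrite ffunE liftK. Qed.

Lemma sum_ffun_cons n (F : {ffun 'I_n.+1 -> 'I_N} -> R) :
  \sum_f F f = \sum_a \sum_f F (ffun_cons a f).
Proof.
rewrite pair_big /= (reindex (fun z : 'I_N * {ffun 'I_n -> 'I_N} => ffun_cons z.1 z.2)) //=.
apply: onW_bij.
exists (fun f : {ffun 'I_n.+1 -> 'I_N} => (f ord0, [ffun k => f (lift ord0 k)])).
  move=> [a f]; rewrite /= ffun_cons0; congr (_, _).
  by apply/ffunP => k; rewrite ffunE ffun_cons_lift.
move=> f; apply/ffunP => k; rewrite ffunE /=.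
by case: unliftP => [k'|] ->; rewrite ?ffunE.
Qed.

(** Value at k of the sequence f 0, ..., f (n - 1), j, j, ... *)
Definition extend n (f : {ffun 'I_n -> 'I_N}) j k :=
  if insub k is Some k' then f k' else j.

Lemma extend_lt n (f : {ffun 'I_n -> 'I_N}) j (k : 'I_n) : extend f j k = f k.
Proof. by rewrite /extend valK. Qed.

Lemma extend_ge n (f : {ffun 'I_n -> 'I_N}) j k : (n <= k)%N -> extend f j k = j.
Proof. by move=> nk; rewrite /extend insubF // ltnNge nk. Qed.

Lemma extend_cons0 n a (f : {ffun 'I_n -> 'I_N}) j : extend (ffun_cons a f) j 0 = a.
Proof. by rewrite (extend_lt _ _ ord0) ffun_cons0. Qed.

Lemma extend_consS n a (f : {ffun 'I_n -> 'I_N}) j k :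
  extend (ffun_cons a f) j k.+1 = extend f j k.
Proof.
have [kn|nk] := ltnP k n; last by rewrite !extend_ge.
rewrite -[k]/(val (Ordinal kn)) extend_lt -(ffun_cons_lift a).
by rewrite -(extend_lt _ j) /= /bump.
Qed.

Lemma prod_mx_entry n (A : 'I_n -> 'M[R]_N) i j :
  (\big[mulmx/1%:M]_(k < n) A k) i j
  = \sum_(f : {ffun 'I_n -> 'I_N}) (extend f j 0 == i)%:R
      * \prod_(k < n) A k (extend f j k) (extend f j k.+1).
Proof.
elim: n A i => [|n IH] A i.
  rewrite big_ord0 (big_pred1 [ffun x => j]) => [|f]; last first.
    by symmetry; apply/eqP/ffunP => -[].
  by rewrite extend_ge // big_ord0 mulr1 !mxE eq_sym.
rewrite big_ord_recl mxE sum_ffun_cons [RHS](bigD1 i) //= [X in _ = _ + X]big1 ?addr0; last first.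
  by move=> a /negPf ai; apply: big1 => f _; rewrite extend_cons0 ai mul0r.
under eq_bigr do rewrite IH mulr_sumr.
rewrite exchange_big /=; apply: eq_bigr => f _.
rewrite (bigD1 (extend f j 0)) //= [X in _ + X = _]big1 => [|a /negPf ai]; last first.
  by rewrite eq_sym ai mul0r mulr0.
rewrite addr0 eqxx mul1r extend_cons0 eqxx mul1r big_ord_recl extend_consS extend_cons0.
by congr (_ * _); apply: eq_bigr => k _; rewrite /= /bump /= !extend_consS.
Qed.

Lemma trace_prod_mx n (A : 'I_n -> 'M[R]_N) : (0 < n)%N ->
  \tr (\big[mulmx/1%:M]_(k < n) A k)
  = \sum_(f : {ffun 'I_n -> 'I_N}) \prod_(k < n) A k (f k) (f (ordS k)).
Proof.
case: n A => // n A _; rewrite /mxtrace.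
under eq_bigr do rewrite prod_mx_entry.
rewrite exchange_big /=; apply: eq_bigr => f _.
rewrite (bigD1 (f ord0)) //= [X in _ + X]big1 => [|a /negPf af]; last first.
  by rewrite (extend_lt _ _ ord0) eq_sym af mul0r.
rewrite addr0 (extend_lt _ _ ord0) eqxx mul1r; apply: eq_bigr => k _.
rewrite extend_lt; congr (A k _ _).
have [kn|kn] := ltnP k.+1 n.+1.
  rewrite (extend_lt _ _ (Ordinal kn)); congr (f _); apply: val_inj.
  by rewrite /= modn_small.
rewrite extend_ge //; congr (f _); apply: val_inj => /=.
by rewrite (_ : k.+1 = n.+1) ?modnn //; apply/eqP; rewrite eqn_leq kn ltn_ord.
Qed.

End TraceOfWord.

Section TraceOfWords.
Variables (R : comPzRingType) (N : nat) (L : lattice) (G : seq (seq (letter L))).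
Hypothesis G_neq0 : forall i : 'I_(size G), nth [::] G i != [::].
Variable X : edge L -> 'M[R]_N.

Definition letter_mx (a : letter L) : 'M[R]_N := if a.2 then X a.1 else (X a.1)^T.

Local Notation idx := {ffun strand G * bool -> 'I_N}.

Lemma prod_trace_strand :
  \prod_(i < size G) \tr (\big[mulmx/1%:M]_(a <- nth [::] G i) letter_mx a)
  = \sum_(f : {ffun strand G -> 'I_N})
      \prod_x letter_mx (strand_letter x) (f x) (f (next_strand x)).
Proof.
pose A (i : 'I_(size G)) (k : 'I_(size (nth [::] G i))) :=
  letter_mx (tnth (in_tuple (nth [::] G i)) k).
transitivity (\prod_(i < size G) \sum_(f : {ffun 'I_(size (nth [::] G i)) -> 'I_N})
    \prod_k A i k (f k) (f (ordS k))).
  apply: eq_bigr => i _; rewrite -trace_prod_mx ?lt0n ?size_eq0 //.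
  by congr (\tr _); rewrite big_tnth.
rewrite prod_sum_ffun_sigma; apply: eq_bigr => f _.
pose tg (i : 'I_(size G)) (k : 'I_(size (nth [::] G i))) : strand G :=
  Tagged (fun i : 'I_(size G) => 'I_(size (nth [::] G i))) k.
transitivity (\prod_(i < size G) \prod_(k < size (nth [::] G i))
    A i k (f (tg i k)) (f (tg i (ordS k)))).
  by apply: eq_bigr => i _; apply: eq_bigr => k _; rewrite !ffunE.
by rewrite (sig_big_dep xpredT (fun _ => xpredT)
  (fun i k => A i k (f (tg i k)) (f (tg i (ordS k))))) /=; apply: eq_bigr => -[i k] _.
Qed.

Definition yellow_compatible (I : idx) :=
  [forall u, forall v, yellow_glued u v ==> (I u == I v)].

(** A letter e^-1 contributes the transpose of the matrix of e, and its strand is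
    traversed from right to left: either way, the entry taken is the one indexed
    by the left and the right vertex of the strand. *)
Lemma sum_yellow_compatible :
  \sum_(f : {ffun strand G -> 'I_N})
      \prod_x letter_mx (strand_letter x) (f x) (f (next_strand x))
  = \sum_(I : idx | yellow_compatible I)
      \prod_x X (strand_edge x) (I (x, false)) (I (x, true)).
Proof.
pose h (f : {ffun strand G -> 'I_N}) : idx :=
  [ffun u => if u.2 == ~~ (strand_letter u.1).2 then f u.1 else f (next_strand u.1)].
have hstart f x : h f (strand_start x) = f x by rewrite ffunE eqxx.
have hend f x : h f (strand_end x) = f (next_strand x).
  by rewrite ffunE /=; case: (strand_letter x).2.
(* A compatible I is determined by its values at the starts of the strands. *)
rewrite [RHS](reindex_onto h (fun I => [ffun x => I (strand_start x)])) /=; last first.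
  move=> I /forallP Iy; apply/ffunP => -[x b].
  have [->|bx] := eqVneq b (~~ (strand_letter x).2).
    by rewrite -[(x, _)]/(strand_start x) hstart ffunE.
  have -> : (x, b) = strand_end x.
    by rewrite /strand_end; case: b (strand_letter x).2 bx => [] [].
  rewrite hend ffunE; have /forallP/(_ (strand_start (next_strand x))) := Iy (strand_end x).
  move=> /implyP/(_ _)/eqP <- //.
  by apply/existsP; exists x; rewrite !eqxx.
apply: eq_big => [f|f _].
  symmetry; apply/andP; split.
    apply/forallP => u; apply/forallP => v; apply/implyP => /existsP[x /andP[/eqP -> /eqP ->]].
    by rewrite hend hstart.
  by apply/eqP/ffunP => x; rewrite ffunE hstart.
apply: eq_bigr => x _; rewrite /letter_mx -/(strand_edge x).
have := hstart f x; have := hend f x; rewrite /strand_start /strand_end /strand_edge.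
by case: (strand_letter x).2 => /= -> ->; rewrite ?mxE.
Qed.

End TraceOfWords.

(** * The glued map: compatible assignments and Euler characteristic *)

Lemma components_partition (T : finType) (r : rel T) :
  symmetric r -> partition (components r) [set: T].
Proof.
move=> r_sym; apply: equivalence_partitionP => x y z _ _ _; split; first exact: connect0.
by move=> xy; apply: same_connect => //; exact: sym_connect_sym.
Qed.

Lemma components_eq (T : finType) (r : rel T) (C C' : {set T}) x : symmetric r ->
  C \in components r -> C' \in components r -> x \in C -> x \in C' -> C = C'.
Proof.
move=> r_sym CP C'P xC xC'; have /and3P[_ triv _] := components_partition r_sym.
by rewrite -(def_pblock triv CP xC) (def_pblock triv C'P xC').
Qed.

Lemma components_step (T : finType) (r : rel T) (C : {set T}) x y : symmetric r ->
  C \in components r -> x \in C -> r x y -> y \in C.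
Proof.
move=> r_sym /imsetP[z _ ->]; rewrite !inE /= => zx xy.
exact: connect_trans zx (connect1 xy).
Qed.

Lemma components_inhabited (T : finType) (r : rel T) (C : {set T}) :
  C \in components r -> exists x, x \in C.
Proof. by move=> /imsetP[z _ ->]; exists z; rewrite !inE connect0. Qed.

Section GluedMap.
Variables (L : lattice) (G : seq (seq (letter L))).
Hypothesis G_neq0 : forall i : 'I_(size G), nth [::] G i != [::].
Implicit Types (e : edge L) (F : matching_family G).

Lemma strand_edge_at e (i : 'I_(nocc G e)) : strand_edge (strand_at i) = e.
Proof. by have := enum_valP i; rewrite inE => /eqP. Qed.

Lemma joined_sym e (pi : matching (nocc G e)) : symmetric (joined pi).
Proof.
move=> x y; apply/existsP/existsP => -[i /existsP[j /and3P[xi yj ij]]];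
  by exists j; apply/existsP; exists i; rewrite xi yj setUC.
Qed.

Lemma glued_sym F : symmetric (glued F).
Proof.
move=> u v; rewrite /glued orbCA; congr (_ || (_ || _)).
apply: eq_existsb => e; rewrite ![joined _ u.1 v.1]joined_sym.
by rewrite andbCA [X in _ || X]andbCA.
Qed.

Section Compatible.
Variable N : nat.
Implicit Types I : {ffun strand G * bool -> 'I_N}.

Definition side_index e b I : {ffun 'I_(nocc G e) -> 'I_N} :=
  [ffun i => I (strand_at i, b)].

Lemma compatible_glued F I :
  compatible (glued F) I = yellow_compatible I &&
    [forall e, const_on (val (pi_left F e)) (side_index e false I)
            && const_on (val (pi_right F e)) (side_index e true I)].
Proof.
apply/idP/andP => [/forallP Ic|[/forallP Iy /forallP Ib]].
  split.
    apply/forallP => u; apply/forallP => v; apply/implyP => uv.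
    by have /forallP/(_ v)/implyP := Ic u; apply; rewrite /glued uv.
  apply/forallP => e; apply/andP; split; apply/forallP => i; apply/forallP => j;
    apply/implyP => ij; rewrite !ffunE.
    have /forallP/(_ (strand_at j, false))/implyP := Ic (strand_at i, false); apply.
    apply/or3P; apply: Or33; apply/existsP; exists e; rewrite /=; apply/orP; left.
    by apply/existsP; exists i; apply/existsP; exists j; rewrite !eqxx.
  have /forallP/(_ (strand_at j, true))/implyP := Ic (strand_at i, true); apply.
  apply/or3P; apply: Or33; apply/existsP; exists e; rewrite /=.
  by apply/existsP; exists i; apply/existsP; exists j; rewrite !eqxx.
apply/forallP => -[x b]; apply/forallP => -[y c]; apply/implyP => /or3P[xy|xy|].
- by have /forallP/(_ (y, c))/implyP := Iy (x, b); apply.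
- by rewrite eq_sym; have /forallP/(_ (x, b))/implyP := Iy (y, c); apply.
move=> /existsP[e] /=; have /andP[/forallP Il /forallP Ir] := Ib e.
move=> /orP[]/and3P[b_eq c_eq /existsP[i /existsP[j /and3P[/eqP -> /eqP -> ij]]]].
  rewrite (negPf b_eq) (negPf c_eq); have /forallP/(_ j) := Il i.
  by rewrite ij !ffunE.
rewrite b_eq c_eq; have /forallP/(_ j) := Ir i.
by rewrite ij !ffunE.
Qed.

(** Expanding every edge factor over pairs of matchings and exchanging the sums,
    a family of matchings is weighted by the number of index assignments
    constant on the corners that it glues. *)
Lemma sum_yellow_prod_matching (R : realFieldType)
    (W : forall e, matching (nocc G e) -> matching (nocc G e) -> R) :
  \sum_(I : {ffun strand G * bool -> 'I_N} | yellow_compatible I)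
     \prod_(e : edge L) \sum_pi \sum_rho
       matching_tensor R pi (side_index e false I) * W e pi rho
         * matching_tensor R rho (side_index e true I)
  = \sum_(F : matching_family G)
      (\prod_(e : edge L) W e (pi_left F e) (pi_right F e))
        * N%:R ^+ #|components (glued F)|.
Proof.
under eq_bigr => I _.
  under eq_bigr do rewrite pair_big /=.
  rewrite (prod_sum_dffun (T := fun e => matching (nocc G e) * matching (nocc G e))%type).
  over.
rewrite exchange_big /=; apply: eq_bigr => F _.
rewrite -natrX -[X in (X ^ _)%N]card_ord -card_compatible; last exact: glued_sym.
rewrite mulr_natr -sumr_const big_mkcond [RHS]big_mkcond /=; apply: eq_bigr => I _.
rewrite inE compatible_glued; case: yellow_compatible => //=.
case: ifP => [/forallP Fc|/negbT].
  apply: eq_bigr => e _; rewrite /matching_tensor.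
  by have /andP[-> ->] := Fc e; rewrite mul1r mulr1.
rewrite negb_forall => /existsP[e eF]; rewrite (bigD1 e) //= /matching_tensor.
rewrite -[X in X * _]mulrA [X in _ * X * _]mulrC mulrA -natrM mulnb.
by rewrite (negPf eF) !mul0r.
Qed.

End Compatible.

Lemma card_strand : #|{: strand G}| = (\sum_(e : edge L) nocc G e)%N.
Proof.
rewrite -sum1_card (partition_big (@strand_edge L G) predT) //=.
by apply: eq_bigr => e _; rewrite /nocc -sum1_card; apply: eq_bigl => x; rewrite inE.
Qed.

Lemma prod_strand (R : comPzRingType) (f : strand G -> R) :
  \prod_x f x = \prod_(e : edge L) \prod_(i < nocc G e) f (strand_at i).
Proof.
rewrite (partition_big (@strand_edge L G) predT) //=; apply: eq_bigr => e _.
rewrite /strand_at /nocc -big_enum_val.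
by apply: eq_bigl => x; rewrite inE.
Qed.

Lemma yellow_face_inj : injective (@yellow_face L G).
Proof.
move=> i j ij; have i0 : (0 < size (nth [::] G i))%N by rewrite lt0n size_eq0.
pose x : strand G := Tagged (fun i : 'I_(size G) => 'I_(size (nth [::] G i))) (Ordinal i0).
have : x \in yellow_face i by rewrite inE.
by rewrite ij inE => /eqP.
Qed.

Lemma card_yellow n : (n <= size G)%N ->
  #|[set @yellow_face L G i | i : 'I_(size G) & (n <= i)%N]| = (size G - n)%N.
Proof.
move=> nG; rewrite card_in_imset; last by move=> i j _ _; exact: yellow_face_inj.
have := cardC [pred i : 'I_(size G) | (i < n)%N].
rewrite card_ord -[in X in (X + _)%N]sum1_card -(big_ord_widen _ (fun=> 1%N) nG).
rewrite sum1_card card_ord => cC.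
transitivity #|[predC [pred i : 'I_(size G) | (i < n)%N]]|.
  by apply: eq_card => i; rewrite !inE -leqNgt.
by rewrite -[X in (X - n)%N]cC addKn.
Qed.

(** The strands of a blue face determine its lattice edge, and also the component
    it comes from, as the two vertices of a strand are connected. *)
Lemma card_blue F :
  #|\bigcup_(e : edge L) blue_faces_at F e|
  = (\sum_(e : edge L) ncycles (pi_left F e) (pi_right F e))%N.
Proof.
have face e B : B \in blue_faces_at F e -> exists2 x, x \in B & strand_edge x = e.
  move=> /imsetP[C CP ->]; have [u uC] := components_inhabited CP.
  exists (strand_at u.1); last exact: strand_edge_at.
  by apply/imsetP; exists u.
have faceE e B x : B \in blue_faces_at F e -> x \in B -> strand_edge x = e.
  by move=> /imsetP[C _ ->] /imsetP[u _ ->]; exact: strand_edge_at.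
rewrite -sum1_card partition_disjoint_bigcup /= => [|e e' ee']; last first.
  rewrite -setI_eq0; apply/eqP/setP => B; rewrite in_setI in_set0.
  apply/negP => /andP[Be Be']; have [x xB xe] := face _ _ Be.
  by move: ee'; rewrite -xe (faceE _ _ _ Be' xB) eqxx.
apply: eq_bigr => e _; rewrite sum1_card card_in_imset // => C C' CP C'P CC'.
have [u uC] := components_inhabited CP.
have : strand_at u.1 \in [set strand_at v.1 | v in C'].
  by rewrite -CC'; apply/imsetP; exists u.
move=> /imsetP[v vC' /enum_val_inj uv].
have gS := strand_graph_sym (pi_left F e) (pi_right F e).
apply: (components_eq gS CP C'P uC); apply: (components_step gS C'P vC').
by rewrite /strand_graph uv eqxx.
Qed.

Lemma euler_char_glued n F : (n <= size G)%N ->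
  euler_char (glued_map n F) = #|components (glued F)|%:Z - #|{: strand G}|%:Z
    + ((size G - n)%N%:Z + (\sum_(e : edge L) ncycles (pi_left F e) (pi_right F e))%N%:Z).
Proof. by move=> nG; rewrite /euler_char /= card_yellow // card_blue. Qed.

End GluedMap.

From mathcomp Require Import all_classical all_reals all_analysis.
From mathcomp Require Import measurable_realfun.
Import Order.TTheory GRing.Theory Num.Theory.
Import numFieldNormedType.Exports.

(** * The Weingarten function as a projection *)

Section WeingartenProjection.
Variables (R : realType) (m N : nat).
Local Notation idx := {ffun 'I_m -> 'I_N}.
Implicit Types (I J : idx) (pi rho : matching m).

Let mt pi J : R := matching_tensor R pi J.

Lemma gram_mxE pi rho :
  \sum_I mt pi I * mt rho I = N%:R ^+ ncycles pi rho.
Proof.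
transitivity (\sum_(I : idx | const_on (val pi) I && const_on (val rho) I) (1 : R)).
  rewrite [RHS]big_mkcond; apply: eq_bigr => I _; rewrite /mt /matching_tensor.
  by do 2!case: const_on => /=; rewrite ?mulr0 ?mulr1.
rewrite sumr_const -natrX -[X in (X ^ _)%N]card_ord -card_const_on.
by congr (_ *+ _); apply: eq_card => I; rewrite inE.
Qed.

Let B : 'M[R]_(#|{: matching m}|, #|{: idx}|) :=
  \matrix_(i, j) mt (enum_val i) (enum_val j).

Let BBT : B *m B^T = gram_mx (N%:R : R) m.
Proof.
apply/matrixP => i j; rewrite !mxE -gram_mxE.
rewrite [RHS](reindex _ (onW_bij _ (@enum_val_bij _))) /=.
by apply: eq_bigr => k _; rewrite !mxE.
Qed.

(** For M = (G W - 1) B and G = B B^T, the product M M^T has (G W - 1) G = 0 as a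
    factor. *)
Let gram_Wg : gram_mx (N%:R : R) m *m mp_pinv (gram_mx (N%:R : R) m) *m B = B.
Proof.
have [GWG _ _ _] := mp_pinvP (gram_mx (N%:R : R) m).
move: (mp_pinv _) GWG => W GWG.
apply/eqP; rewrite -subr_eq0 -{2}[B]mul1mx -mulmxBl; apply/eqP.
apply: mulmx_trmx_eq0; rewrite trmx_mul mulmxA -(mulmxA _ B) BBT mulmxBl GWG.
by rewrite mul1mx subrr mul0mx.
Qed.

Lemma gram_WgE pi J :
  \sum_rho N%:R ^+ ncycles pi rho * (\sum_rho' Wg N%:R rho rho' * mt rho' J) = mt pi J.
Proof.
have := congr1 (fun M => fun_of_matrix M (enum_rank pi) (enum_rank J)) gram_Wg.
rewrite -mulmxA !mxE !enum_rankK => <-.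
rewrite [LHS](reindex _ (onW_bij _ (@enum_val_bij _))) /=.
apply: eq_bigr => i _; rewrite !mxE enum_rankK; congr (_ * _).
rewrite [LHS](reindex _ (onW_bij _ (@enum_val_bij _))) /=.
by apply: eq_bigr => j _; rewrite /Wg !mxE enum_valK enum_rankK enum_valK.
Qed.

(** Such an E is the orthogonal projection onto the span of the matching
    tensors, and the pseudo-inverse of their Gram matrix is what that projection
    needs as coefficients, whether or not they are linearly independent. *)
Lemma invariant_projection_Wg (E : idx -> idx -> R) :
  (forall J, orth_invariant (E^~ J)) ->
  (forall pi J, \sum_I mt pi I * E I J = mt pi J) ->
  forall I J, E I J = \sum_pi \sum_rho mt pi I * Wg N%:R pi rho * mt rho J.
Proof.
move=> EI Emt I J; apply/eqP; rewrite -subr_eq0; apply/eqP.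
pose c pi := \sum_rho Wg (N%:R : R) pi rho * mt rho J.
pose w I := E I J - \sum_pi mt pi I * c pi.
transitivity (w I).
  rewrite /w; congr (_ - _); apply: eq_bigr => pi _; rewrite mulr_sumr.
  by apply: eq_bigr => rho _; rewrite mulrA.
apply: orth_invariant_eq0_matching.
  move=> g gg I'; rewrite /w -[E I' J](EI J g gg I').
  under eq_bigr do rewrite mulrBr mulr_sumr.
  rewrite sumrB; congr (_ - _); rewrite exchange_big /=; apply: eq_bigr => pi _.
  under eq_bigr do rewrite mulrA.
  by rewrite -mulr_suml (matching_tensor_invariant pi gg).
move=> pi; rewrite /w; under eq_bigr do rewrite mulrBr mulr_sumr.
rewrite sumrB Emt exchange_big /= -[in X in X - _](gram_WgE pi J) -sumrB big1 // => rho _.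
by under eq_bigr do rewrite mulrA; rewrite -mulr_suml gram_mxE subrr.
Qed.

End WeingartenProjection.

Local Open Scope classical_set_scope.
Local Open Scope ring_scope.

(** * Bounded measurable functions and product probabilities *)

Section BoundedMeasurable.
Context d (T : measurableType d) (R : realType).
Implicit Types f g : T -> R.

(** A class closed under sums and products, on which integration against a
    probability is finite and linear. *)
Definition bounded_measurable f :=
  measurable_fun setT f /\ exists M, forall x, `|f x| <= M.

Lemma bounded_measurable_cst r : bounded_measurable (fun=> r).
Proof. by split; [exact: measurable_cst|exists `|r|]. Qed.

Lemma bounded_measurableD f g : bounded_measurable f -> bounded_measurable g ->
  bounded_measurable (fun x => f x + g x).
Proof.
move=> [mf [M fM]] [mg [M' gM]]; split; first exact: measurable_funD.
by exists (M + M') => x; rewrite (le_trans (ler_normD _ _)) // lerD.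
Qed.

Lemma bounded_measurableM f g : bounded_measurable f -> bounded_measurable g ->
  bounded_measurable (fun x => f x * g x).
Proof.
move=> [mf [M fM]] [mg [M' gM]]; split; first exact: measurable_funM.
by exists (M * M') => x; rewrite normrM ler_pM.
Qed.

Lemma bounded_measurable_sum (I : Type) (s : seq I) (P : pred I) (f : I -> T -> R) :
  (forall i, bounded_measurable (f i)) ->
  bounded_measurable (fun x => \sum_(i <- s | P i) f i x).
Proof.
move=> bf; elim: s => [|i s IH].
  by under eq_fun do rewrite big_nil; exact: bounded_measurable_cst.
under eq_fun do rewrite big_cons; case: (P i) => //.
exact: bounded_measurableD.
Qed.

Lemma bounded_measurable_prod (I : Type) (s : seq I) (P : pred I) (f : I -> T -> R) :
  (forall i, bounded_measurable (f i)) ->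
  bounded_measurable (fun x => \prod_(i <- s | P i) f i x).
Proof.
move=> bf; elim: s => [|i s IH].
  by under eq_fun do rewrite big_nil; exact: bounded_measurable_cst.
under eq_fun do rewrite big_cons; case: (P i) => //.
exact: bounded_measurableM.
Qed.

Lemma bounded_measurable_exp f n : bounded_measurable f ->
  bounded_measurable (fun x => f x ^+ n).
Proof.
move=> bf; elim: n => [|n IH].
  by under eq_fun do rewrite expr0; exact: bounded_measurable_cst.
by under eq_fun do rewrite exprS; exact: bounded_measurableM.
Qed.

Variable P : probability T R.

Lemma bounded_measurable_integrable f :
  bounded_measurable f -> P.-integrable setT (EFin \o f).
Proof.
move=> [mf [M fM]]; apply: measurable_bounded_integrable => //.
  by rewrite (le_lt_trans (probability_le1 _ _)) // ltry.
exists M; split; first exact: num_real.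
by move=> x Mx y _; exact: le_trans (fM y) (ltW Mx).
Qed.

Lemma Rintegral_sum (I : Type) (s : seq I) (Q : pred I) (f : I -> T -> R) :
  (forall i, bounded_measurable (f i)) ->
  \int[P]_(x in setT) (\sum_(i <- s | Q i) f i x)
  = \sum_(i <- s | Q i) \int[P]_(x in setT) f i x.
Proof.
move=> bf; elim: s => [|i s IH].
  by rewrite big_nil; under eq_Rintegral do rewrite big_nil; rewrite Rintegral_cst // mul0r.
rewrite big_cons -IH; under eq_Rintegral do rewrite big_cons.
case: (Q i) => //; apply: RintegralD => //; apply: bounded_measurable_integrable => //.
exact: bounded_measurable_sum.
Qed.

Lemma Rintegral_scale r f : bounded_measurable f ->
  \int[P]_(x in setT) (r * f x) = r * \int[P]_(x in setT) f x.
Proof. by move=> bf; apply: RintegralZl => //; exact: bounded_measurable_integrable. Qed.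

Lemma Rintegral_prob_cst r : \int[P]_(x in setT) (r : R) = r.
Proof. by rewrite Rintegral_cst // [X in fine X]probability_setT /= mulr1. Qed.

Lemma Rintegral_norm_le f M : bounded_measurable f -> (forall x, `|f x| <= M) ->
  `|\int[P]_(x in setT) f x| <= M.
Proof.
move=> bf fM; apply: le_trans (le_normr_Rintegral _ _) _ => //.
  exact: bounded_measurable_integrable.
rewrite -[leRHS]Rintegral_prob_cst; apply: le_Rintegral => //.
  apply: bounded_measurable_integrable; have [mf [M' fM']] := bf.
  by split; [exact: measurableT_comp|exists M' => x; rewrite normr_id].
by apply: bounded_measurable_integrable; exact: bounded_measurable_cst.
Qed.

End BoundedMeasurable.

Lemma bounded_measurable_comp d d' (T : measurableType d) (T' : measurableType d') (R : realType)
    (h : T -> T') (f : T' -> R) :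
  measurable_fun setT h -> bounded_measurable f -> bounded_measurable (f \o h).
Proof.
move=> mh [mf [M fM]]; split; first exact: measurableT_comp.
by exists M => x; exact: fM.
Qed.

Section ProductIntegral.
Context d (T : measurableType d) (R : realType) (P : probability T R).

Lemma Rintegral_prod2 d' (T' : measurableType d') (P' : probability T' R) f g :
  bounded_measurable f -> bounded_measurable g ->
  \int[(P \x P')%E]_(z in setT) (f z.1 * g z.2)
  = (\int[P]_(x in setT) f x) * \int[P']_(y in setT) g y.
Proof.
move=> bf bg; have bfg : bounded_measurable (fun z : T * T' => f z.1 * g z.2).
  apply: bounded_measurableM; first exact: (bounded_measurable_comp measurable_fst).
  exact: (bounded_measurable_comp measurable_snd).
have := bounded_measurable_integrable (P \x P')%E bfg.
move=> ifg; rewrite {1}/Rintegral -(integral12_prod_meas1 ifg).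
transitivity (fine (\int[P]_x (f x * \int[P']_(y in setT) g y)%:E)%E); last first.
  by rewrite -[RHS]mulrC -Rintegral_scale //; under [in RHS]eq_Rintegral do rewrite mulrC.
congr fine; apply: eq_integral => x _; rewrite /fubini_F /= -Rintegral_scale // /Rintegral.
rewrite fineK //; apply: integrable_fin_num => //; apply: bounded_measurable_integrable.
by apply: bounded_measurableM => //; exact: bounded_measurable_cst.
Qed.

Lemma Rintegral_prob_pow n (f : 'I_n -> T -> R) :
  (forall i, bounded_measurable (f i)) ->
  \int[prob_pow P n]_(Q in setT) (\prod_(i < n) f i (tnth Q i))
  = \prod_(i < n) \int[P]_(x in setT) f i x.
Proof.
elim: n f => [|n IH] f bf.
  by rewrite big_ord0; under eq_Rintegral do rewrite big_ord0; rewrite Rintegral_prob_cst.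
rewrite big_ord_recl -IH // -Rintegral_prod2 //; last first.
  apply: bounded_measurable_prod => i.
  by apply: (bounded_measurable_comp (measurable_tnth i)); exact: bf.
have bF : bounded_measurable (fun Q : n.+1.-tuple T => \prod_(i < n.+1) f i (tnth Q i)).
  apply: bounded_measurable_prod => i.
  by apply: (bounded_measurable_comp (measurable_tnth i)); exact: bf.
rewrite /Rintegral /= integral_distribution.
- congr fine; apply: eq_integral => -[x y] _ /=; rewrite big_ord_recl; congr (_ * _)%:E.
  by apply: eq_bigr => i _; rewrite tnthS.
- by apply/measurable_EFinP; case: bF.
- apply: (@bounded_measurable_integrable _ _ _ _
    ((fun Q : n.+1.-tuple T => \prod_(i < n.+1) f i (tnth Q i)) \o @tuple_cons _ T n)).
  by apply: bounded_measurable_comp => //; exact: measurable_tuple_cons.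
Qed.

End ProductIntegral.

Section OrthogonalEntries.
Variables (R : realType) (N : nat).

Lemma measurable_entry i j :
  measurable_fun setT (fun Q : borel_orthogonal R N => (Q : 'M[R]_N) i j).
Proof.
apply: (measurability _ (RGenOInfty.measurableE R)) => /= _ [_ [a ->]] <-.
rewrite setTI; apply: sub_sigma_algebra.
have : continuous (fun Q : orthogonal_mx R N => (Q : 'M[R]_N) i j).
  move=> Q; apply: (@continuous_comp _ _ _ (@mx_of_orthogonal R N) (fun M : 'M[R]_N => M i j)).
    exact: initial_continuous.
  exact: coord_continuous.
by move=> /continuousP; apply; exact: interval_open.
Qed.

Lemma norm_entry_le1 (Q : orthogonal_mx R N) i j : `|(Q : 'M[R]_N) i j| <= 1.
Proof.
have := congr1 (fun M : 'M[R]_N => M i i) (orthogonal_mulmxT Q); rewrite !mxE eqxx.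
under eq_bigr do rewrite mxE -expr2.
rewrite (bigD1 j) //= => Qij; rewrite -(@expr_le1 _ 2) // -normrX ger0_norm ?sqr_ge0 //.
by rewrite -[leRHS]Qij lerDl sumr_ge0 // => k _; exact: sqr_ge0.
Qed.

Lemma bounded_measurable_entry i j :
  bounded_measurable (fun Q : borel_orthogonal R N => (Q : 'M[R]_N) i j).
Proof. by split; [exact: measurable_entry|exists 1 => Q; exact: norm_entry_le1]. Qed.

End OrthogonalEntries.

(** * Moments of Haar measure on O(N) *)

Section HaarMoments.
Variables (R : realType) (N : nat).
Variables (haar : probability (borel_orthogonal R N) R).

Lemma continuous_mulmx_left (g : 'M[R]_N) : continuous (fun M : 'M[R]_N => g *m M).
Proof.
move=> M A /= [P PgM PA].
have near_entry i j : \forall M' \near M, P i j ((g *m M') i j).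
  apply: (_ : (fun M' : 'M[R]_N => (g *m M') i j) @ M --> (g *m M) i j); last exact: PgM.
  have -> : (fun M' : 'M[R]_N => (g *m M') i j) = (fun M' => \sum_k g i k * M' k j).
    by apply/funext => M'; rewrite mxE.
  rewrite mxE; apply: cvg_big => [||k _]; [exact: add_continuous|exact: (nbhs_filter M)|].
  by apply: cvgMr; [exact: (nbhs_filter M)|exact: coord_continuous].
have : \forall M' \near M, forall i j, P i j ((g *m M') i j).
  have FM : Filter (nbhs M) by exact: (nbhs_filter M).
  apply: (@filter_forall _ _ (fun i M' => forall j, P i j ((g *m M') i j)) _ FM) => i.
  exact: (@filter_forall _ _ (fun j M' => P i j ((g *m M') i j)) _ FM (near_entry i)).
move=> all; have FM : Filter (nbhs M) by exact: (nbhs_filter M).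
apply: (@filterS _ _ FM _ _ _ all) => M' PM'; exact: PA.
Qed.

Lemma measurable_mulg_left (g : orthogonal_mx R N) :
  measurable_fun setT
    ((fun h : orthogonal_mx R N => (g * h)%g) : borel_orthogonal R N -> borel_orthogonal R N).
Proof.
refine (@measurability _ _ (borel_orthogonal R N) (borel_orthogonal R N) setT _
  (@open (orthogonal_mx R N)) _ _) => [//|_ [A oA <-]].
rewrite setTI; apply: sub_sigma_algebra.
have cL : continuous (fun h : orthogonal_mx R N => (g * h)%g : orthogonal_mx R N).
  apply: continuous_comp_initial => h.
  apply: (@continuous_comp _ _ _ (@mx_of_orthogonal R N) (fun M : 'M[R]_N => (g : 'M[R]_N) *m M)).
    exact: initial_continuous.
  exact: continuous_mulmx_left.
by move/continuousP : cL; apply.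
Qed.

Hypothesis haarP : is_haar haar.

Lemma Rintegral_haar_mulg (g : orthogonal_mx R N) (f : borel_orthogonal R N -> R) :
  bounded_measurable f ->
  \int[haar]_(h in setT) f ((g * h)%g : orthogonal_mx R N) = \int[haar]_(h in setT) f h.
Proof.
move=> bf; rewrite /Rintegral; congr fine.
pose L : borel_orthogonal R N -> borel_orthogonal R N := fun h : orthogonal_mx R N => (g * h)%g.
have mL : measurable_fun setT L := measurable_mulg_left g.
have bfL : bounded_measurable (f \o L) by exact: bounded_measurable_comp.
have mf : measurable_fun setT (EFin \o f) by apply/measurable_EFinP; case: bf.
transitivity (\int[pushforward haar L]_(h in setT) (EFin \o f) h)%E.
  by rewrite (integral_pushforward mL mf) //=; exact: (bounded_measurable_integrable haar bfL).
by apply: eq_measure_integral => A mA _; exact: haarP.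
Qed.

(** Left invariance of the measure makes the tensor of moments invariant in its
    left indices, and it fixes the matching tensors because every Q does. *)
Lemma haar_moment m (I J : {ffun 'I_m -> 'I_N}) :
  \int[haar]_(Q in setT) (\prod_x (Q : 'M[R]_N) (I x) (J x))
  = \sum_pi \sum_rho matching_tensor R pi I * Wg N%:R pi rho * matching_tensor R rho J.
Proof.
have bprod (I' J' : {ffun 'I_m -> 'I_N}) : bounded_measurable (fun Q : borel_orthogonal R N =>
    \prod_x (Q : 'M[R]_N) (I' x) (J' x)).
  by apply: bounded_measurable_prod => x; exact: bounded_measurable_entry.
pose E (I J : {ffun 'I_m -> 'I_N}) : R :=
  \int[haar]_(Q in setT) (\prod_x (Q : 'M[R]_N) (I x) (J x)).
rewrite -[LHS]/(E I J); apply: invariant_projection_Wg => {I J} [J g gg I|pi J].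
  have gP : g *m g^T == 1%:M by apply/eqP.
  pose g' := Orthogonal gP.
  rewrite /= /E -(Rintegral_haar_mulg g' (bprod I J)).
  have -> : \int[haar]_(h in setT) \prod_x ((g' * h)%g : orthogonal_mx R N) (I x) (J x)
      = \int[haar]_(h in setT) \sum_(I' : {ffun 'I_m -> 'I_N})
          (\prod_x g (I x) (I' x)) * \prod_x (h : 'M[R]_N) (I' x) (J x).
    apply: eq_Rintegral => h _.
    transitivity (\prod_x \sum_k g (I x) k * (h : 'M[R]_N) k (J x)).
      by apply: eq_bigr => x _; rewrite [LHS]mxE.
    rewrite bigA_distr_bigA /=; apply: eq_bigr => I' _.
    by rewrite big_split.
  rewrite Rintegral_sum; last first.
    by move=> I'; apply: bounded_measurableM => //; exact: bounded_measurable_cst.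
  by apply: eq_bigr => I' _; rewrite Rintegral_scale.
rewrite /E; under eq_bigr do rewrite -Rintegral_scale //.
rewrite -Rintegral_sum; last first.
  by move=> I'; apply: bounded_measurableM => //; exact: bounded_measurable_cst.
rewrite -[RHS](Rintegral_prob_cst haar); apply: eq_Rintegral => Q _.
have QQ : (Q : 'M[R]_N)^T *m ((Q : 'M[R]_N)^T)^T = 1%:M.
  by rewrite trmxK orthogonal_mulTmx.
rewrite -[RHS](matching_tensor_invariant pi QQ J); apply: eq_bigr => I _.
by rewrite mulrC; congr (_ * _); apply: eq_bigr => x _; rewrite mxE.
Qed.

End HaarMoments.

(** * The surface expansion, term by term *)

Section WordIntegral.
Variables (R : realType) (L : lattice) (N : nat).
Variables (haar : probability (borel_orthogonal R N) R) (haarP : is_haar haar).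
Implicit Types (Q : configuration R L N).

Lemma holonomyE Q w :
  (holonomy Q w : 'M[R]_N) = \big[mulmx/1%:M]_(a <- w) letter_mx (fun e => link Q e : 'M[R]_N) a.
Proof.
rewrite /holonomy; elim: w => [|a w IH]; first by rewrite !big_nil.
rewrite !big_cons -IH; congr (_ *m _); rewrite /letter_mx.
by case: a.2.
Qed.

Lemma measurable_link e :
  measurable_fun setT (fun Q : configuration R L N => link Q e : borel_orthogonal R N).
Proof. exact: measurable_tnth. Qed.

Lemma bounded_measurable_link e i j :
  bounded_measurable (fun Q : configuration R L N => (link Q e : 'M[R]_N) i j).
Proof.
exact: (bounded_measurable_comp (measurable_link e) (@bounded_measurable_entry R N i j)).
Qed.

Lemma bounded_measurable_trace_holonomy w :
  bounded_measurable (fun Q : configuration R L N => \tr (holonomy Q w : 'M[R]_N)).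
Proof.
rewrite /mxtrace; apply: bounded_measurable_sum => i; move: {2}i => j.
under eq_fun do rewrite holonomyE.
elim: w i => [|a w IH] i.
  by under eq_fun do rewrite big_nil; exact: bounded_measurable_cst.
under eq_fun do rewrite big_cons mxE.
apply: bounded_measurable_sum => k; apply: bounded_measurableM; last exact: IH.
rewrite /letter_mx; case: a.2; first exact: bounded_measurable_link.
by under eq_fun do rewrite mxE; exact: bounded_measurable_link.
Qed.

Lemma Rintegral_links (n : edge L -> nat) (I J : forall e, {ffun 'I_(n e) -> 'I_N}) :
  \int[haar_product L haar]_(Q in setT)
    \prod_e \prod_(x < n e) (link Q e : 'M[R]_N) (I e x) (J e x)
  = \prod_e \sum_pi \sum_rho matching_tensor R pi (I e) * Wg N%:R pi rho
      * matching_tensor R rho (J e).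
Proof.
pose f (k : 'I_#|edge L|) (q : borel_orthogonal R N) : R :=
  \prod_(x < n (enum_val k)) (q : 'M[R]_N) (I (enum_val k) x) (J (enum_val k) x).
transitivity (\int[haar_product L haar]_(Q in setT) \prod_k f k (tnth Q k)).
  apply: eq_Rintegral => Q _; rewrite (reindex _ (onW_bij _ (@enum_val_bij (edge L)))) /=.
  by apply: eq_bigr => k _; rewrite /f /link enum_valK.
rewrite Rintegral_prob_pow => [|k]; last first.
  by apply: bounded_measurable_prod => x; exact: bounded_measurable_entry.
rewrite [RHS](reindex _ (onW_bij _ (@enum_val_bij (edge L)))) /=.
by apply: eq_bigr => k _; rewrite /f haar_moment.
Qed.

(** Once the traces are expanded, the integrand factors over the edges of the
    lattice, and each factor integrates to a moment of Haar measure. *)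
Lemma Rintegral_words (G : seq (seq (letter L))) :
  (forall i : 'I_(size G), nth [::] G i != [::]) ->
  \int[haar_product L haar]_(Q in setT)
    \prod_(w <- G) \tr (holonomy Q w : 'M[R]_N)
  = \sum_(F : matching_family G)
      (\prod_(e : edge L) Wg (N%:R : R) (pi_left F e) (pi_right F e))
        * N%:R ^+ #|components (glued F)|.
Proof.
move=> G_neq0.
transitivity (\int[haar_product L haar]_(Q in setT)
    \sum_(I : {ffun strand G * bool -> 'I_N} | yellow_compatible I)
      \prod_e \prod_(i < nocc G e) (link Q e : 'M[R]_N)
         (side_index e false I i) (side_index e true I i)).
  apply: eq_Rintegral => Q _; rewrite (big_nth [::]) big_mkord.
  under eq_bigr do rewrite holonomyE.
  rewrite prod_trace_strand // sum_yellow_compatible; apply: eq_bigr => I _.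
  rewrite prod_strand; apply: eq_bigr => e _; apply: eq_bigr => i _.
  by rewrite strand_edge_at !ffunE.
rewrite Rintegral_sum => [|I]; last first.
  apply: bounded_measurable_prod => e; apply: bounded_measurable_prod => i.
  exact: bounded_measurable_link.
rewrite -(@sum_yellow_prod_matching L G N R (fun e => @Wg R N%:R (nocc G e))).
apply: eq_bigr => I _.
exact: Rintegral_links.
Qed.

End WordIntegral.

Section SurfaceExpansion.
Variables (R : realType) (L : lattice) (P : {fset loop L}) (N : nat).
Hypothesis N_gt0 : (0 < N)%N.
Variables (haar : probability (borel_orthogonal R N) R) (haarP : is_haar haar).
Variable beta : R.
Implicit Types (Q : configuration R L N) (s : seq (loop L)) (K : {ffun P -> nat}).

Lemma word_neq0 (l : loop L) : word l != [::].
Proof. by rewrite /word; case: (repr l) => w /= /andP[]. Qed.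

Lemma size_Gamma s K : size (Gamma s K) = (size s + \sum_(p : P) K p)%N.
Proof.
rewrite size_cat size_map size_flatten /shape -map_comp sumnE big_map.
by congr (_ + _)%N; rewrite big_enum /=; apply: eq_bigr => p _; rewrite /= size_nseq.
Qed.

Lemma Gamma_neq0 s K (i : 'I_(size (Gamma s K))) : nth [::] (Gamma s K) i != [::].
Proof.
have : nth [::] (Gamma s K) i \in Gamma s K by exact: mem_nth.
rewrite mem_cat => /orP[/mapP[l _ ->]|]; first exact: word_neq0.
by move=> /flattenP[ws /mapP[p _ ->]]; rewrite mem_nseq => /andP[_ /eqP ->]; exact: word_neq0.
Qed.

Lemma prod_Gamma (f : seq (letter L) -> R) s K :
  \prod_(w <- Gamma s K) f w
  = (\prod_(l <- s) f (word l)) * \prod_(p : P) f (word (val p)) ^+ K p.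
Proof.
rewrite big_cat big_map; congr (_ * _); rewrite big_flatten big_map big_enum /=.
by apply: eq_bigr => p _; rewrite big_nseq -Monoid.iteropE.
Qed.

(** The order K p in every plaquette p of the integrand of Z <W_s>. *)
Definition expansion_term s K Q : R :=
  wilson s Q * \prod_(p : P) ((N%:R * beta * loop_trace Q (val p)) ^+ K p / (K p)`!%:R).

(** The normalization of the Weingarten functions cancels the edges and the blue
    faces in the Euler characteristic. This leaves the vertices, the yellow faces,
    of which each plaquette p has K p copies, and the exponent - n. *)
Lemma EPE_termE s K (F : EPE s K) :
  EPE_term N beta F
  = beta ^+ (\sum_(p : P) K p) / (\prod_(p : P) (K p)`!)%:R
     * (N%:R ^+ (\sum_(p : P) K p) / N%:R ^+ size s)
     * ((\prod_(e : edge L) Wg (N%:R : R) (pi_left F e) (pi_right F e))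
        * N%:R ^+ #|components (glued F)|).
Proof.
have N0 : N%:R != 0 :> R by rewrite pnatr_eq0 -lt0n.
set V := #|components _|; set n := size s; set Y := (\sum_(p : P) K p)%N.
pose m := (\sum_(e : edge L) nocc (Gamma s K) e)%N.
pose c := (\sum_(e : edge L) ncycles (pi_left F e) (pi_right F e))%N.
have WgE : EPE_Wg R N F = N%:R ^ (m%:Z - c%:Z)
    * \prod_(e : edge L) Wg (N%:R : R) (pi_left F e) (pi_right F e).
  rewrite /EPE_Wg big_split /=; congr (_ * _).
  rewrite -(big_morph (fun z : int => (N%:R : R) ^ z) (fun a b => expfzDr a b N0) (expr0z _)).
  by rewrite sumrB -!(big_morph Posz PoszD erefl).
have chiE : euler_char (EPE_map F) - n%:Z = V%:Z - m%:Z + (Y%:Z + c%:Z) - n%:Z.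
  rewrite /EPE_map euler_char_glued; [|exact: Gamma_neq0|by rewrite size_Gamma leq_addr].
  by rewrite card_strand size_Gamma addKn.
have NE : N%:R ^ (m%:Z - c%:Z) * N%:R ^ (V%:Z - m%:Z + (Y%:Z + c%:Z) - n%:Z)
    = N%:R ^+ Y / N%:R ^+ n * N%:R ^+ V :> R.
  rewrite -expfzDr // (_ : _ + _ = Y%:Z - n%:Z + V%:Z); last by ring.
  by rewrite !expfzDr // -exprnP -exprnN exprnP.
rewrite /EPE_term /area /phi_factorial chiE WgE; move: NE; set W := \prod_(e : edge L) _.
rewrite -/Y; move: (_ ^+ Y / _%:R) (N%:R ^ (m%:Z - c%:Z)) (N%:R ^ (_ - n%:Z)) => b A B.
move: (N%:R ^+ Y / N%:R ^+ n) (N%:R ^+ V) W => q v W AB.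
by transitivity (b * W * (A * B)); [ring|rewrite AB; ring].
Qed.

Lemma EPE_sumE s K :
  EPE_sum N beta s K = \int[haar_product L haar]_(Q in setT) expansion_term s K Q.
Proof.
pose c : R := beta ^+ (\sum_(p : P) K p) / (\prod_(p : P) (K p)`!)%:R
     * (N%:R ^+ (\sum_(p : P) K p) / N%:R ^+ size s).
transitivity (c * \int[haar_product L haar]_(Q in setT)
    \prod_(w <- Gamma s K) \tr (holonomy Q w : 'M[R]_N)).
  rewrite Rintegral_words //; last exact: Gamma_neq0.
  by rewrite /EPE_sum mulr_sumr; apply: eq_bigr => F _; rewrite EPE_termE.
rewrite -Rintegral_scale; last first.
  apply: bounded_measurable_prod => w; exact: bounded_measurable_trace_holonomy.
apply: eq_Rintegral => Q _; rewrite prod_Gamma /expansion_term /wilson big_split /=.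
have -> : \prod_(p : P) ((N%:R * beta * loop_trace Q (val p)) ^+ K p / (K p)`!%:R)
    = N%:R ^+ (\sum_(p : P) K p) * beta ^+ (\sum_(p : P) K p)
      * (\prod_(p : P) loop_trace Q (val p) ^+ K p) / (\prod_(p : P) (K p)`!)%:R.
  by under eq_bigr do rewrite !exprMn; rewrite !big_split /= !prodrXr prodfV natr_prod.
have -> : \prod_(l <- s) N%:R^-1 = (N%:R ^+ size s)^-1 :> R.
  by rewrite big_const_seq count_predT iter_mulr mulr1 exprVn.
rewrite /c /loop_trace.
move: (\prod_(l <- s) \tr (holonomy Q (word l) : 'M[R]_N)) => A.
move: (\prod_(p : P) \tr (holonomy Q (word (val p)) : 'M[R]_N) ^+ K p) => B.
move: (beta ^+ _) (N%:R ^+ (\sum_(p : P) K p)) (N%:R ^+ size s)^-1 (_%:R^-1) => b y n' f.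
ring.
Qed.

End SurfaceExpansion.

(** * Summation along exhausting finite sets *)

Section Exhaustion.
Variables (R : realType) (T : choiceType) (box : nat -> seq T).
Hypotheses (box_uniq : forall n, uniq (box n))
  (box_mono : forall m n, (m <= n)%N -> {subset box m <= box n})
  (box_exhaust : forall x, exists n, x \in box n).

Lemma finite_set_box (A : set T) : finite_set A -> exists n, forall x, A x -> x \in box n.
Proof.
move=> /finite_seqP[s ->]; elim: s => [|x s [n sn]]; first by exists 0.
have [m xm] := box_exhaust x; exists (maxn m n) => y; rewrite /= inE => /orP[/eqP ->|ys].
  by apply: box_mono xm; exact: leq_maxl.
by apply: box_mono (sn _ ys); exact: leq_maxr.
Qed.

Lemma esum_le_box (g : T -> \bar R) M : (forall i, 0 <= g i)%E ->
  (forall n, \sum_(i <- box n) g i <= M)%E -> (\esum_(i in setT) g i <= M)%E.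
Proof.
move=> g0 gM; apply: ge_ereal_sup => _ [A [finA _] <-].
have [n An] := finite_set_box finA; apply: le_trans (gM n).
rewrite [leRHS]fsbig_seq //; apply: lee_fsum_nneg_subset => // x; rewrite !inE.
exact: An.
Qed.

Lemma cvg_box_esum (g : T -> \bar R) : (forall i, 0 <= g i)%E ->
  (\sum_(i <- box n) g i)%E @[n --> \oo] --> (\esum_(i in setT) g i)%E.
Proof.
move=> g0; set u := fun n => (\sum_(i <- box n) g i)%E.
have u_le n : (u n <= \esum_(i in setT) g i)%E.
  rewrite /u fsbig_seq //; apply: ereal_sup_ubound; exists [set` box n]; last by [].
  by split; [exact: finite_seq|exact: subsetT].
have -> : (\esum_(i in setT) g i)%E = ereal_sup (range u).
  apply/eqP; rewrite eq_le; apply/andP; split.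
    by apply: esum_le_box => // n; apply: ereal_sup_ubound; exists n.
  by apply: ge_ereal_sup => _ [n _ <-].
apply: ereal_nondecreasing_cvgn => m n mn; rewrite /u [leLHS]fsbig_seq // [leRHS]fsbig_seq //.
apply: lee_fsum_nneg_subset => //; first by move=> x; rewrite !inE /=; exact: box_mono.
Qed.

(** Positive and negative parts are treated separately, as in the definition of
    the unordered sum. *)
Lemma cvg_box_usum (f : T -> R) : summable setT (EFin \o f) ->
  \sum_(i <- box n) f i @[n --> \oo] --> usum f.
Proof.
move=> sf; set fp := ((EFin \o f)^\+)%E; set fm := ((EFin \o f)^\-)%E.
have esum_fin (g : T -> \bar R) : (forall i, 0 <= g i)%E -> (forall i, g i <= `|(f i)%:E|)%E ->
    (\esum_(i in setT) g i)%E \is a fin_num.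
  move=> g0 gf; rewrite ge0_fin_numE; last exact: esum_ge0.
  by apply: le_lt_trans sf; apply: le_esum => i _; exact: gf.
have fpE i : fp i = (Num.max (f i) 0)%:E by rewrite /fp funeposE EFin_max.
have fmE i : fm i = (Num.max (- f i) 0)%:E by rewrite /fm funenegE EFin_max.
have ip : (\esum_(i in setT) fp i)%E \is a fin_num.
  apply: esum_fin => i; rewrite fpE lee_fin ?le_max ?lexx ?orbT //.
  by rewrite ge_max ler_norm normr_ge0.
have im : (\esum_(i in setT) fm i)%E \is a fin_num.
  apply: esum_fin => i; rewrite fmE lee_fin ?le_max ?lexx ?orbT //.
  by rewrite ge_max -normrN ler_norm normr_ge0.
have cvg_fin (g : T -> R) : (forall i, 0 <= g i) ->
    (\esum_(i in setT) (g i)%:E)%E \is a fin_num ->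
    \sum_(i <- box n) g i @[n --> \oo] --> fine (\esum_(i in setT) (g i)%:E)%E.
  move=> g0 gfin; have := @cvg_box_esum (fun i => (g i)%:E) g0.
  rewrite -{1}(fineK gfin) => /fine_cvg.
  by apply: cvg_trans; apply: near_eq_cvg; apply: nearW => n /=; rewrite sumEFin.
rewrite /usum fineB //.
have -> : (fun n => \sum_(i <- box n) f i) =
    (fun n => \sum_(i <- box n) Num.max (f i) 0 - \sum_(i <- box n) Num.max (- f i) 0).
  apply/funext => n; rewrite -sumrB; apply: eq_bigr => i _.
  have [fi|/ltW fi] := leP 0 (f i).
    by rewrite [Num.max (- _) _]max_r ?subr0 // oppr_le0.
  by rewrite [Num.max (- _) _]max_l ?oppr_ge0 // sub0r opprK.
have epE := eq_esum (I := setT) (fun i _ => fpE i).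
have emE := eq_esum (I := setT) (fun i _ => fmE i).
rewrite epE in ip *; rewrite emE in im *.
apply: cvgB; apply: cvg_fin => [i|].
- by rewrite le_max lexx orbT.
- exact: ip.
- by rewrite le_max lexx orbT.
- exact: im.
Qed.

End Exhaustion.

(** * Convergence *)

Section Boxes.
Variables (R : realType) (T : finType).

Definition embed n (K : {ffun T -> 'I_n}) : {ffun T -> nat} := [ffun p => K p : nat].

(** Over these finite sets, which exhaust the functions to nat, a sum of products
    factors into a product of partial sums. *)
Definition box n : seq {ffun T -> nat} := [seq embed K | K : {ffun T -> 'I_n}].

Lemma embed_inj n : injective (@embed n).
Proof.
move=> K K' KK'; apply/ffunP => p; apply: val_inj.
by have := congr1 (fun f : {ffun T -> nat} => f p) KK'; rewrite !ffunE.
Qed.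

Lemma box_uniq n : uniq (box n).
Proof. by rewrite map_inj_uniq ?enum_uniq //; exact: embed_inj. Qed.

Lemma mem_box n (K : {ffun T -> nat}) : (K \in box n) = [forall p, (K p < n)%N].
Proof.
rewrite /box; apply/mapP/forallP => [[K' _ ->] p|Kn]; first by rewrite ffunE.
exists [ffun p => Ordinal (Kn p)]; first by rewrite mem_enum.
by apply/ffunP => p; rewrite !ffunE.
Qed.

Lemma box_mono m n : (m <= n)%N -> {subset box m <= box n}.
Proof.
move=> mn K; rewrite !mem_box => /forallP Km; apply/forallP => p.
exact: leq_trans mn.
Qed.

Lemma box_exhaust (K : {ffun T -> nat}) : exists n, K \in box n.
Proof.
exists (\max_p K p).+1; rewrite mem_box; apply/forallP => p.
by rewrite ltnS leq_bigmax.
Qed.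

Lemma sum_box_prod n (F : T -> nat -> R) :
  \sum_(K <- box n) \prod_p F p (K p) = \prod_p \sum_(k < n) F p k.
Proof.
rewrite bigA_distr_bigA /= big_image /=; apply: eq_bigr => K _.
by apply: eq_bigr => p _; rewrite ffunE.
Qed.

End Boxes.

Section ExpPartialSums.
Variable R : realType.
Implicit Types x c : R.

Definition exp_sum n x : R := \sum_(k < n) x ^+ k / k`!%:R.

Lemma exp_sumE n x : exp_sum n x = series (exp_coeff x) n.
Proof. by rewrite /exp_sum /series /= big_mkord. Qed.

Lemma cvg_exp_sum x : exp_sum n x @[n --> \oo] --> expR x.
Proof.
under eq_fun do rewrite exp_sumE.
exact: is_cvg_series_exp_coeff.
Qed.

Lemma exp_sum_le n c : 0 <= c -> exp_sum n c <= expR c.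
Proof.
move=> c0; rewrite exp_sumE; apply: nondecreasing_cvgn_le; last exact: is_cvg_series_exp_coeff.
by apply: nondecreasing_series => k _ _; exact: exp_coeff_ge0.
Qed.

Lemma norm_exp_sum_le n x c : `|x| <= c -> `|exp_sum n x| <= expR c.
Proof.
move=> xc; have c0 : 0 <= c := le_trans (normr_ge0 x) xc.
apply: le_trans (exp_sum_le n c0); apply: le_trans (ler_norm_sum _ _ _) _.
apply: ler_sum => k _; rewrite normrM normrX [X in _ * X]ger0_norm ?invr_ge0 //.
by rewrite ler_wpM2r ?invr_ge0 // lerXn2r ?nnegrE.
Qed.

End ExpPartialSums.

Lemma norm_prod_le (R : realType) (I : Type) (r : seq I) (P : pred I) (f g : I -> R) :
  (forall i, `|f i| <= g i) -> `|\prod_(i <- r | P i) f i| <= \prod_(i <- r | P i) g i.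
Proof. by move=> fg; rewrite normr_prod; apply: ler_prod => i _; rewrite normr_ge0 fg. Qed.

Section Convergence.
Variables (R : realType) (L : lattice) (P : {fset loop L}) (N : nat).
Hypothesis N_gt0 : (0 < N)%N.
Variables (haar : probability (borel_orthogonal R N) R) (haarP : is_haar haar).
Variable beta : R.
Hypothesis beta_gt0 : 0 < beta.
Implicit Types (Q : configuration R L N) (s : seq (loop L)) (K : {ffun P -> nat}).

Lemma norm_loop_trace_le Q (l : loop L) : `|loop_trace Q l| <= N%:R.
Proof.
rewrite /loop_trace /mxtrace (le_trans (ler_norm_sum _ _ _)) //.
rewrite -[X in _ <= X%:R]card_ord -sumr_const; apply: ler_sum => i _.
exact: norm_entry_le1.
Qed.

Lemma norm_wilson_le1 s Q : `|wilson s Q| <= 1.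
Proof.
rewrite -[leRHS](@big1_eq R 1 *%R _ s predT); apply: norm_prod_le => l.
by rewrite normrM ger0_norm ?invr_ge0 // ler_pdivrMl ?ltr0n // mulr1 norm_loop_trace_le.
Qed.

Let c : R := N%:R * beta * N%:R.

Let c_ge0 : 0 <= c. Proof. by rewrite /c !mulr_ge0 // ltW. Qed.

Lemma norm_action_le Q l : `|N%:R * beta * loop_trace Q l| <= c.
Proof.
rewrite normrM ger0_norm ?mulr_ge0 ?(ltW beta_gt0) //.
by rewrite ler_wpM2l ?mulr_ge0 ?(ltW beta_gt0) // norm_loop_trace_le.
Qed.

Lemma bounded_measurable_wilson s :
  bounded_measurable (fun Q : configuration R L N => wilson s Q).
Proof.
apply: bounded_measurable_prod => l; apply: bounded_measurableM.
  exact: bounded_measurable_cst.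
exact: bounded_measurable_trace_holonomy.
Qed.

Lemma bounded_measurable_action l :
  bounded_measurable (fun Q : configuration R L N => N%:R * beta * loop_trace Q l).
Proof.
apply: bounded_measurableM; first exact: bounded_measurable_cst.
exact: bounded_measurable_trace_holonomy.
Qed.

Lemma bounded_measurable_expansion_term s K :
  bounded_measurable (fun Q : configuration R L N => expansion_term beta s K Q).
Proof.
apply: bounded_measurableM; first exact: bounded_measurable_wilson.
apply: bounded_measurable_prod => p; apply: bounded_measurableM.
  exact/bounded_measurable_exp/bounded_measurable_action.
exact: bounded_measurable_cst.
Qed.

Lemma bounded_measurable_weight s :
  bounded_measurable (fun Q : configuration R L N => wilson s Q * ym_weight P beta Q).
Proof.
apply: bounded_measurableM; first exact: bounded_measurable_wilson.
apply: bounded_measurable_prod => p; split.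
  by apply: measurableT_comp => //; case: (bounded_measurable_action (val p)).
exists (expR c) => Q; rewrite ger0_norm ?expR_ge0 // ler_expR.
exact: le_trans (ler_norm _) (norm_action_le _ _).
Qed.

(** The bound is read off the integral, where it is immediate, and not off the
    signed sum over matchings, whose number outgrows the factorials of K. *)
Lemma norm_EPE_sum_le s K : `|EPE_sum N beta s K| <= \prod_(p : P) (c ^+ K p / (K p)`!%:R).
Proof.
rewrite (EPE_sumE N_gt0 haarP); apply: Rintegral_norm_le => [|Q].
  exact: bounded_measurable_expansion_term.
rewrite /expansion_term normrM -[leRHS]mul1r ler_pM ?normr_ge0 ?norm_wilson_le1 //.
apply: norm_prod_le => p; rewrite normrM normrX [X in _ * X]ger0_norm ?invr_ge0 //.
by rewrite ler_wpM2r ?invr_ge0 // lerXn2r ?nnegrE // norm_action_le.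
Qed.

Lemma summable_EPE_sum s : summable setT (EFin \o @EPE_sum R L P N beta s).
Proof.
rewrite /summable; apply: (@le_lt_trans _ _ (expR c ^+ #|{: P}|)%:E); last exact: ltry.
apply: (esum_le_box (@box_uniq P) (@box_mono P) (@box_exhaust P)) => // n.
rewrite sumEFin lee_fin.
apply: (@le_trans _ _ (\sum_(K <- box P n) \prod_(p : P) (c ^+ K p / (K p)`!%:R))).
  by apply: ler_sum => K _; exact: norm_EPE_sum_le.
rewrite (sum_box_prod n (fun _ k => c ^+ k / k`!%:R)) prodr_const.
by rewrite lerXn2r ?nnegrE ?expR_ge0 ?exp_sum_le // sumr_ge0 // => k _; rewrite divr_ge0 ?exprn_ge0.
Qed.

(** The sum over a box is the integral of the Wilson loops times a product of
    partial sums of exponential series, all bounded by the exponential of the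
    largest possible action of a plaquette. *)
Lemma cvg_sum_EPE_sum s :
  \sum_(K <- box P n) EPE_sum N beta s K @[n --> \oo]
    --> \int[haar_product L haar]_(Q in setT) (wilson s Q * ym_weight P beta Q).
Proof.
pose h n Q := wilson s Q * \prod_(p : P) exp_sum n (N%:R * beta * loop_trace Q (val p)).
have hE n : h n = fun Q => \sum_(K <- box P n) expansion_term beta s K Q.
  apply/funext => Q; rewrite /h -(sum_box_prod n (fun p k =>
    (N%:R * beta * loop_trace Q (val p)) ^+ k / k`!%:R)) mulr_sumr.
  by [].
have sumE n : \sum_(K <- box P n) EPE_sum N beta s K
    = \int[haar_product L haar]_(Q in setT) h n Q.
  rewrite hE Rintegral_sum; last by move=> K; exact: bounded_measurable_expansion_term.
  by apply: eq_bigr => K _; rewrite (EPE_sumE N_gt0 haarP).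
under eq_fun do rewrite sumE.
have bh n : bounded_measurable (h n).
  by rewrite hE; apply: bounded_measurable_sum => K; exact: bounded_measurable_expansion_term.
have bw := bounded_measurable_weight s.
have h_cvg Q : h n Q @[n --> \oo] --> wilson s Q * ym_weight P beta Q.
  apply: cvgM; first exact: cvg_cst.
  apply: cvg_big => [|p _]; [exact: mul_continuous|exact: cvg_exp_sum].
have [] := @dominated_convergence _ _ _ (haar_product L haar) setT measurableT
  (fun n => EFin \o h n) (fun Q => (wilson s Q * ym_weight P beta Q)%:E)
  (fun=> (expR c ^+ #|{: P}|)%:E).
- by move=> n; apply/measurable_EFinP; case: (bh n).
- by apply/measurable_EFinP; case: bw.
- apply: aeW => Q _; apply: cvg_EFin; first by near=> n.
  exact: h_cvg.
- by apply: (bounded_measurable_integrable _ (bounded_measurable_cst _ _)).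
- apply: aeW => Q n _; rewrite lee_fin normrM -[leRHS]mul1r.
  rewrite ler_pM ?normr_ge0 ?norm_wilson_le1 // -prodr_const.
  by apply: norm_prod_le => p; apply: norm_exp_sum_le; exact: norm_action_le.
move=> iw _; rewrite -[X in _ --> X](fineK (integrable_fin_num measurableT iw)).
by move=> /fine_cvg.
Unshelve. all: by end_near. Qed.

End Convergence.

Theorem theorem6p19 (R : realType) (L : lattice)
    (P : {fset loop L}) (P_inv : forall p, p \in P -> inv_loop p \in P)
    (N : nat) (N_gt0 : (0 < N)%N)
    (haar : probability (borel_orthogonal R N) R) (haarP : is_haar haar)
    (beta : R) (beta_gt0 : 0 < beta) (s : seq (loop L)) :
  wilson_expectation P haar beta s
    = (partition_function P haar beta)^-1 * usum (@EPE_sum R L P N beta s)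
  /\ summable [set: {ffun P -> nat}] (EFin \o @EPE_sum R L P N beta s).
Proof.
have sumE := summable_EPE_sum P N_gt0 haarP beta_gt0 s.
split=> //; rewrite /wilson_expectation; congr (_ * _).
have int_lim := @cvg_sum_EPE_sum R L P N N_gt0 haar haarP beta beta_gt0 s.
have usum_lim := cvg_box_usum (@box_uniq P) (@box_mono P) (@box_exhaust P) sumE.
by rewrite -(cvg_lim (@Rhausdorff R) int_lim) -(cvg_lim (@Rhausdorff R) usum_lim).
Qed.
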